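(* Let $i\colon A\to X$ be a cofibration of directed graphs and $f\colon A\to Y$ any map of directed graphs. Form the pushout $X\cup_A Y$ in the category of directed graphs, with canonical maps $g\colon X\to X\cup_A Y$ and $j\colon Y\to X\cup_A Y$. Then there is a long exact sequence in bigraded path homology $$\cdots\to\mathrm{PH}_{*,*}(A)\xrightarrow{(i_*,-f_* )}\mathrm{PH}_{*,*}(X)\oplus\mathrm{PH}_{*,*}(Y)\xrightarrow{g_*\oplus j_*}\mathrm{PH}_{*,*}(X\cup_A Y)\xrightarrow{\partial_*}\mathrm{PH}_{*-1,*-1}(A)\to\cdots$$
   Context: Fix a commutative ground ring $R$. A directed graph $G$ has a vertex set $V(G)$ and edge set $E(G)\subseteq V(G)\times V(G)$ (loops allowed). A map of directed graphs $G\to H$ is a function $f\colon V(G)\to V(H)$ such that for each edge $x\to y$ of $G$ either $f(x)=f(y)$ or $f(x)\to f(y)$ is an edge of $H$. The resulting category is cocomplete. The distance $d(x,y)\in\{0,1,\dots,\infty\}$ is the minimal number of edges in a directed path from $x$ to $y$. Cofibrations: for a subgraph $A\subseteq X$, the reach $rA$ is the induced subgraph of $X$ on all vertices that admit a directed path from some vertex of $A$. A cofibration is an induced subgraph inclusion $A\hookrightarrow X$ such that (1) there are no edges from vertices not in $A$ to vertices in $A$; and (2) for each $x\in rA$ there is a vertex $\pi(x)\in A$ with $d(a,x)=d(a,\pi(x))+d(\pi(x),x)$ for every $a\in A$. The reachability complex $\mathrm{RC}_*(G)$ has in degree $k$ the free $R$-module on tuples $(x_0,\dots,x_k)$ of vertices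 with consecutive entries distinct and $d(x_i,x_{i+1})<\infty$ for all $i$; its differential is $\partial(x_0,\dots,x_k)=\sum_{i=0}^k(-1)^i(x_0,\dots,\widehat{x_i},\dots,x_k)$, omitting terms with repeated consecutive entries. The length of a tuple is $\ell(x_0,\dots,x_k)=\sum_i d(x_i,x_{i+1})$, and $F_\ell\mathrm{RC}_*(G)$ is spanned by tuples of length at most $\ell$. The magnitude-path spectral sequence $\{E^r_{*,*}(G),d^r\}_{r\geq0}$ is the spectral sequence of this filtered complex, with $E^0_{i,j}(G)=F_i\mathrm{RC}_{i+j}(G)/F_{i-1}\mathrm{RC}_{i+j}(G)$ and $d^r$ of bidegree $(-r,r-1)$. Bigraded path homology is $\mathrm{PH}_{k,\ell}(G)=E^2_{\ell,k-\ell}(G)$. The map $g_*\oplus j_*$ sends $(u,v)$ to $g_*(u)+j_*(v)$. *)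

(* Defs.v *)
From HB Require Import structures.
From mathcomp Require Import all_boot all_order all_algebra finmap.
From mathcomp Require Import boolp monalg.

Set Implicit Arguments.
Unset Strict Implicit.
Unset Printing Implicit Defensive.

Import Order.TTheory GRing.Theory Num.Theory.

Local Open Scope ring_scope.

(** * Directed graphs *)

(* Loops are allowed and the vertex set may be infinite.  Asking for a
   choiceType is no restriction in the classical setting of boolp. *)
Record digraph := Digraph { vertex :> choiceType; edge : rel vertex }.

Record dihom (G H : digraph) := Dihom {
  dihom_fun :> G -> H;
  dihomP : forall x y : G,
    edge x y -> dihom_fun x = dihom_fun y \/ edge (dihom_fun x) (dihom_fun y) }.

Definition is_pushout (A X Y P : digraph) (i : dihom A X) (f : dihom A Y)
    (g : dihom X P) (j : dihom Y P) : Prop :=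
  (forall a, g (i a) = j (f a)) /\
  forall (Z : digraph) (u : dihom X Z) (v : dihom Y Z),
    (forall a, u (i a) = v (f a)) ->
    exists w : dihom P Z,
      [/\ forall x, w (g x) = u x, forall y, w (j y) = v y &
          forall w' : dihom P Z,
            (forall x, w' (g x) = u x) -> (forall y, w' (j y) = v y) ->
            forall p, w' p = w p].

Section Distance.
Variable G : digraph.
Implicit Types (x y z : G) (s : seq G).

Definition has_path_of_size x y (n : nat) : bool :=
  `[< exists p : seq G, [/\ path (@edge G) x p, last x p = y & size p = n] >].

(* [None] stands for infinity. *)
Definition dist x y : option nat :=
  if pselect (exists n, has_path_of_size x y n) is left h
  then Some (ex_minn h) else None.

Definition reachable x y : bool := dist x y != None.

Lemma reachableP x y :
  reflect (exists2 p, path (@edge G) x p & last x p = y) (reachable x y).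
Proof.
rewrite /reachable /dist; case: pselect => [h|h].
  apply: (iffP idP) => // _.
  by case: h => n /asboolP[p [? ? ?]]; exists p.
apply: (iffP idP) => // -[p pp lp]; case: h.
by exists (size p); apply/asboolP; exists p.
Qed.

End Distance.

(* Addition of distances, with value infinity as soon as one term is. *)
Definition add_dist (m n : option nat) : option nat :=
  if (m, n) is (Some a, Some b) then Some (a + b)%N else None.

Definition cofibration (A X : digraph) (i : dihom A X) : Prop :=
  [/\ injective i,
      forall a b, edge (i a) (i b) = edge a b,
      forall (x : X) (a : A), (forall b, i b <> x) -> ~~ edge x (i a) &
      forall x : X, (exists a, reachable (i a) x) ->
        exists p : A, forall a : A,
          dist (i a) x = add_dist (dist (i a) (i p)) (dist (i p) x)].

(** * Subquotients of modules *)

Section Subquotient.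
Variables (R : pzRingType) (V : lmodType R).

Definition submod_of (Z : submodClosed V) := {x : V | x \in Z}.

Section Submod.
Variable Z : submodClosed V.
HB.instance Definition _ := SubChoice.on (submod_of Z).
HB.instance Definition _ := [SubChoice_isSubLmodule of submod_of Z by <:].

Definition submod_trace (B : submodClosed V) : {pred submod_of Z} :=
  [pred x : submod_of Z | val x \in B].

Variable B : submodClosed V.

Lemma submod_trace_closed : submod_closed (submod_trace B).
Proof.
split=> [|a x y]; rewrite !inE ?raddf0 ?rpred0 //= => Bx By.
by rewrite rpredD // rpredZ.
Qed.
HB.instance Definition _ :=
  GRing.isSubmodClosed.Build R (submod_of Z) (submod_trace B)
    submod_trace_closed.
Lemma submod_trace_oppr_closed : oppr_closed (submod_trace B).
Proof. by move=> x Bx; rewrite -scaleN1r rpredZ. Qed.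
HB.instance Definition _ :=
  GRing.isOppClosed.Build (submod_of Z) (submod_trace B)
    submod_trace_oppr_closed.

(* The quotient Z / (Z :&: B). *)
Definition subquot := Quotient.quot (submod_trace B).
HB.instance Definition _ := EqQuotient.on subquot.
HB.instance Definition _ := GRing.Zmodule.on subquot.

Definition subquot_pi (x : submod_of Z) : subquot := (\pi_subquot x)%qT.

Lemma subquot_pi_eq (x y : submod_of Z) :
  subquot_pi x = subquot_pi y <-> val x - val y \in B.
Proof.
rewrite /subquot_pi; split => [/eqP|h]; last apply/eqP.
  by rewrite -Quotient.idealrBE inE raddfB.
by rewrite -Quotient.idealrBE inE raddfB.
Qed.

Lemma subquot_piK (q : subquot) : subquot_pi (repr q) = q.
Proof. exact: reprK. Qed.

Lemma subquot_piD x y : subquot_pi (x + y) = subquot_pi x + subquot_pi y.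
Proof. by rewrite /subquot_pi raddfD. Qed.

Definition subquot_scale (a : R) (q : subquot) : subquot :=
  subquot_pi (a *: repr q).

Lemma subquot_piZ a x : subquot_pi (a *: x) = subquot_scale a (subquot_pi x).
Proof.
have h : val x - val (repr (subquot_pi x)) \in B.
  by apply/subquot_pi_eq; rewrite subquot_piK.
by apply/subquot_pi_eq; rewrite /= -scalerBr rpredZ.
Qed.

Fact subquot_scaleA a b q :
  subquot_scale a (subquot_scale b q) = subquot_scale (a * b) q.
Proof. by rewrite -(subquot_piK q) -!subquot_piZ scalerA. Qed.
Fact subquot_scale1 : left_id 1 subquot_scale.
Proof. by move=> q; rewrite -(subquot_piK q) -!subquot_piZ scale1r. Qed.
Fact subquot_scaleDr : right_distributive subquot_scale +%R.
Proof.
move=> a p q; rewrite -(subquot_piK q) -(subquot_piK p).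
by rewrite -subquot_piD -!subquot_piZ -subquot_piD scalerDr.
Qed.
Fact subquot_scaleDl q : {morph subquot_scale^~ q : a b / a + b}.
Proof.
by move=> a b; rewrite -(subquot_piK q) -!subquot_piZ -subquot_piD scalerDl.
Qed.
HB.instance Definition _ := GRing.Zmodule_isLmodule.Build R subquot
  subquot_scaleA subquot_scale1 subquot_scaleDr subquot_scaleDl.

Fact subquot_pi_is_linear : linear subquot_pi.
Proof. by move=> a x y; rewrite subquot_piD subquot_piZ. Qed.
HB.instance Definition _ :=
  GRing.isLinear.Build R (submod_of Z) subquot *:%R subquot_pi
    subquot_pi_is_linear.

End Submod.
End Subquotient.

Section SubquotientMap.
Variables (R : pzRingType) (V W : lmodType R).
Variables (Z B : submodClosed V) (Z' B' : submodClosed W).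
Variable h : {linear V -> W}.
Hypothesis hZ : forall x, x \in Z -> h x \in Z'.
Hypothesis hB : forall x, x \in B -> h x \in B'.

Definition submod_map (x : submod_of Z) : submod_of Z' := Sub (h (val x)) (hZ (valP x)).

Definition subquot_map_fun (q : subquot Z B) : subquot Z' B' :=
  subquot_pi B' (submod_map (repr q)).

Fact subquot_map_funE x :
  subquot_map_fun (subquot_pi B x) = subquot_pi B' (submod_map x).
Proof.
apply/subquot_pi_eq => /=; rewrite -raddfB; apply: hB.
by apply/subquot_pi_eq; rewrite subquot_piK.
Qed.

Fact subquot_map_is_linear : linear subquot_map_fun.
Proof.
move=> a p q.
rewrite -(subquot_piK p) -(subquot_piK q) -linearP !subquot_map_funE.
by rewrite -linearP; congr subquot_pi; apply: val_inj; rewrite /= linearP.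
Qed.

Definition subquot_map : {linear subquot Z B -> subquot Z' B'} :=
  HB.pack subquot_map_fun
    (GRing.isLinear.Build R (subquot Z B) (subquot Z' B') *:%R subquot_map_fun
      subquot_map_is_linear).

Lemma subquot_mapE x :
  subquot_map (subquot_pi B x) = subquot_pi B' (submod_map x).
Proof. exact: subquot_map_funE. Qed.

End SubquotientMap.
Arguments subquot_map {R V W Z B Z' B' h} hZ hB.

(** * The spectral sequence of a filtered complex *)

(* The carrier is the total module of the complex; [fil p n] is the piece of
   filtration degree p of its degree-n part, a submodule of the total module. *)
Record filteredComplex (R : pzRingType) := FilteredComplex {
  fc_mod :> lmodType R;
  fil : int -> int -> submodClosed fc_mod;
  fc_d : {linear fc_mod -> fc_mod};
  fc_dd : forall x, fc_d (fc_d x) = 0;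
  fil_incl : forall p n x, x \in fil p n -> x \in fil (p + 1) n;
  fil_d : forall p n x, x \in fil p n -> fc_d x \in fil p (n - 1) }.

Record filteredMap (R : pzRingType) (C D : filteredComplex R) := FilteredMap {
  fm_fun :> {linear C -> D};
  fm_d : forall x, fm_fun (fc_d C x) = fc_d D (fm_fun x);
  fm_fil : forall p n x, x \in fil C p n -> fm_fun x \in fil D p n }.

Section Pages.
Variables (R : pzRingType) (C : filteredComplex R).
Local Notation d := (fc_d C).

(* The elements of F_p C_n whose differential lies in F_(p - r). *)
Definition cycles (r p n : int) : {pred C} :=
  [pred x | (x \in fil C p n) && (d x \in fil C (p - r) (n - 1))].

Fact cycles_closed r p n : submod_closed (cycles r p n).
Proof.
split=> [|a x y]; rewrite !inE ?raddf0 ?rpred0 //= linearP.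
by move=> /andP[? ?] /andP[? ?]; rewrite !rpredD ?rpredZ.
Qed.
HB.instance Definition _ r p n :=
  GRing.isSubmodClosed.Build R C (cycles r p n) (cycles_closed r p n).

Definition boundaries (r p n : int) : {pred C} :=
  [pred x | `[< exists y z : C,
    [/\ y \in cycles (r - 1) (p - 1) n,
        z \in cycles (r - 1) (p + r - 1) (n + 1) & x = y + d z] >] ].

Fact boundaries_closed r p n : submod_closed (boundaries r p n).
Proof.
split=> [|a x y].
  by rewrite inE; apply/asboolP; exists 0, 0; rewrite raddf0 addr0 !rpred0.
rewrite !inE => /asboolP[u [v [hu hv ->]]] /asboolP[u' [v' [hu' hv' ->]]].
apply/asboolP; exists (a *: u + u'), (a *: v + v').
by rewrite !rpredD ?rpredZ // linearP scalerDr addrACA.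
Qed.
HB.instance Definition _ r p n :=
  GRing.isSubmodClosed.Build R C (boundaries r p n) (boundaries_closed r p n).

(* E^r_(p, q), in total degree p + q:
   Z^r_p / (Z^(r-1)_(p-1) + d Z^(r-1)_(p+r-1)) with Z^r_p = cycles r p (p + q).
   For r = 0 this is F_p / F_(p-1), see [cycles0] and [boundaries0]. *)
Definition page (r : nat) (p q : int) : lmodType R :=
  subquot (cycles r%:Z p (p + q)) (boundaries r%:Z p (p + q)).

Lemma fil_incl1 p n x : x \in fil C (p - 1) n -> x \in fil C p n.
Proof. by move/fil_incl; rewrite subrK. Qed.

Lemma cycles0 p n x : (x \in cycles 0 p n) = (x \in fil C p n).
Proof. by rewrite inE subr0; apply/andb_idr/fil_d. Qed.

Lemma boundaries0 p n x : (x \in boundaries 0 p n) = (x \in fil C (p - 1) n).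
Proof.
rewrite inE; apply/asboolP/idP.
  case=> y [z [/andP[yF _] /andP[zF _] ->]].
  rewrite rpredD //; move: zF => /fil_d.
  by rewrite addr0 addrK.
move=> xF; exists x, 0; rewrite rpred0 raddf0 addr0; split=> //.
by rewrite inE xF /=; apply/fil_d; rewrite sub0r opprK subrK fil_incl1.
Qed.

Lemma boundaries_sub_cycles r p n x :
  x \in boundaries r p n -> x \in cycles r p n.
Proof.
rewrite inE => /asboolP[y [z [/andP[yF dyF] /andP[_ dzF] ->]]].
have e1 : p - 1 - (r - 1) = p - r by rewrite opprB addrA subrK.
have e2 : p + r - 1 - (r - 1) = p by rewrite opprB addrA subrK addrK.
move: dyF dzF; rewrite /= e1 e2 addrK => dyF dzF.
apply/andP; split; first by rewrite rpredD // fil_incl1.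
by rewrite linearD /= fc_dd addr0.
Qed.

(* The differential d^r, of bidegree (- r, r - 1). *)
Fact page_d_total (r : nat) (p q : int) :
  (p - r%:Z) + (q + r%:Z - 1) = p + q - 1.
Proof. by rewrite !addrA [p - _ + q]addrAC subrK. Qed.

Fact cycles_d (r : nat) p q x : x \in cycles r%:Z p (p + q) ->
  d x \in cycles r%:Z (p - r%:Z) ((p - r%:Z) + (q + r%:Z - 1)).
Proof.
rewrite page_d_total => /andP[_ xd]; apply/andP; split=> //.
by rewrite fc_dd rpred0.
Qed.

Fact boundaries_d (r : nat) p q x : x \in boundaries r%:Z p (p + q) ->
  d x \in boundaries r%:Z (p - r%:Z) ((p - r%:Z) + (q + r%:Z - 1)).
Proof.
rewrite page_d_total !inE => /asboolP[y [z [yZ zZ ->]]].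
apply/asboolP; exists 0, y; rewrite add0r rpred0 linearD /= fc_dd addr0.
by split=> //; rewrite !subrK.
Qed.

Definition page_d (r : nat) (p q : int) :
    {linear page r p q -> page r (p - r%:Z) (q + r%:Z - 1)} :=
  subquot_map (@cycles_d r p q) (@boundaries_d r p q).

End Pages.
Arguments cycles {R} C r p n.
Arguments boundaries {R} C r p n.
Arguments page {R} C r p q.

Section PageMap.
Variables (R : pzRingType) (C D : filteredComplex R) (h : filteredMap C D).

Fact cycles_map r p n x : x \in cycles C r p n -> h x \in cycles D r p n.
Proof. by rewrite !inE -fm_d => /andP[/fm_fil-> /fm_fil->]. Qed.

Fact boundaries_map r p n x :
  x \in boundaries C r p n -> h x \in boundaries D r p n.
Proof.
rewrite !inE => /asboolP[y [z [yZ zZ ->]]].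
by apply/asboolP; exists (h y), (h z); rewrite raddfD -fm_d !cycles_map.
Qed.

Definition page_map (r : nat) (p q : int) :
    {linear page C r p q -> page D r p q} :=
  subquot_map (@cycles_map r%:Z p (p + q)) (@boundaries_map r%:Z p (p + q)).

End PageMap.

(** * Free modules *)

(* The library only provides the module structure of {malg R[K]} over a
   nontrivial ring R. *)
Definition freemod (R : pzRingType) (K : choiceType) := {malg R[K]}.

Section FreeModule.
Variables (R : pzRingType) (K : choiceType).
HB.instance Definition _ := GRing.Zmodule.on (freemod R K).
Implicit Types x y : freemod R K.

Definition freemod_scale (c : R) x : freemod R K :=
  \sum_(k <- msupp x) << c * x@_k *g k >>.

Fact freemod_scaleE c x k : (freemod_scale c x)@_k = c * x@_k.
Proof.
rewrite {2}[x]monalgE !raddf_sum mulr_sumr.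
by apply/eq_bigr=> /= i _; rewrite !mcoeffU mulrnAr.
Qed.
Fact freemod_scaleA a b x :
  freemod_scale a (freemod_scale b x) = freemod_scale (a * b) x.
Proof. by apply/malgP=> k; rewrite !freemod_scaleE mulrA. Qed.
Fact freemod_scale1 : left_id 1 freemod_scale.
Proof. by move=> x; apply/malgP=> k; rewrite freemod_scaleE mul1r. Qed.
Fact freemod_scaleDr : right_distributive freemod_scale +%R.
Proof.
by move=> c x y; apply/malgP=> k; rewrite !(mcoeffD, freemod_scaleE) mulrDr.
Qed.
Fact freemod_scaleDl x : {morph freemod_scale^~ x : a b / a + b}.
Proof.
by move=> a b; apply/malgP=> k; rewrite !(mcoeffD, freemod_scaleE) mulrDl.
Qed.
HB.instance Definition _ := GRing.Zmodule_isLmodule.Build R (freemod R K)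
  freemod_scaleA freemod_scale1 freemod_scaleDr freemod_scaleDl.

Lemma freemod_mcoeffZ c x k : (c *: x)@_k = c * x@_k.
Proof. exact: freemod_scaleE. Qed.

Definition freemod_gen (k : K) : freemod R K := << 1 *g k >>.

Lemma freemodE x : x = \sum_(k <- msupp x) x@_k *: freemod_gen k.
Proof.
rewrite [LHS]monalgE; apply: eq_bigr => k _; apply/malgP => k'.
by rewrite freemod_mcoeffZ !mcoeffU mulrnAr mulr1.
Qed.

(* Linear extension of a map defined on the basis. *)
Section Lift.
Variables (V : lmodType R) (h : K -> V).

Definition freemod_lift x : V := \sum_(k <- msupp x) x@_k *: h k.

Lemma freemod_liftEw x (s : {fset K}) : (msupp x `<=` s)%fset ->
  freemod_lift x = \sum_(k <- s) x@_k *: h k.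
Proof.
move=> xs; rewrite /freemod_lift (big_fset_incl _ xs) // => k _ kx.
by rewrite mcoeff_outdom ?scale0r.
Qed.

Fact freemod_lift_is_linear : linear freemod_lift.
Proof.
move=> a x y; pose s := (msupp x `|` msupp y `|` msupp (a *: x + y))%fset.
have sx : (msupp x `<=` s)%fset by rewrite /s -fsetUA fsubsetUl.
have sy : (msupp y `<=` s)%fset.
  by rewrite /s fsubsetU // fsubsetUr.
rewrite (freemod_liftEw sx) (freemod_liftEw sy) (@freemod_liftEw _ s) ?fsubsetUr //.
rewrite scaler_sumr -big_split; apply: eq_bigr => k _ /=.
by rewrite mcoeffD freemod_mcoeffZ scalerDl scalerA.
Qed.
HB.instance Definition _ :=
  GRing.isLinear.Build R (freemod R K) V *:%R freemod_lift
    freemod_lift_is_linear.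

Lemma freemod_lift_gen k : freemod_lift (freemod_gen k) = h k.
Proof.
rewrite (@freemod_liftEw _ [fset k]%fset) ?msuppU_le //.
by rewrite big_seq_fset1 mcoeffUU scale1r.
Qed.

End Lift.

(* The submodule spanned by the basis elements satisfying a predicate. *)
Definition freemod_span (S : pred K) : {pred freemod R K} :=
  [pred x : freemod R K | `[< forall k, k \in msupp x -> S k >] ].

Fact freemod_span_closed S : submod_closed (freemod_span S).
Proof.
split=> [|a x y]; rewrite !inE.
  by apply/asboolP => k; rewrite msupp0.
move=> /asboolP hx /asboolP hy; apply/asboolP => k.
apply: contraTT => Sk; rewrite -mcoeff_eq0 mcoeffD freemod_mcoeffZ.
have /negPf kx : k \notin msupp x by apply: contra Sk; apply: hx.
have /negPf ky : k \notin msupp y by apply: contra Sk; apply: hy.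
by rewrite !mcoeff_outdom ?kx ?ky // mulr0 addr0.
Qed.
HB.instance Definition _ S :=
  GRing.isSubmodClosed.Build R (freemod R K) (freemod_span S)
    (freemod_span_closed S).

Lemma freemod_span_gen (S : pred K) k : S k -> freemod_gen k \in freemod_span S.
Proof.
move=> Sk; rewrite inE; apply/asboolP => k'.
by move/(fsubsetP msuppU_le); rewrite in_fset1 => /eqP->.
Qed.

End FreeModule.

Lemma freemod_span_lift (R : pzRingType) (K : choiceType) (V : lmodType R)
    (h : K -> V) (S : pred K) (W : submodClosed V) (x : freemod R K) :
  (forall k, S k -> h k \in W) -> x \in freemod_span S -> freemod_lift h x \in W.
Proof.
move=> hW; rewrite inE => /asboolP xS; rewrite /freemod_lift big_seq.
by apply: rpred_sum => k kx; rewrite rpredZ // hW // xS.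
Qed.

(** * The reachability complex *)

Definition face (T : Type) (i : nat) (s : seq T) : seq T :=
  take i s ++ drop i.+1 s.
Arguments face : simpl never.

Section Faces.
Local Open Scope nat_scope.
Variable T : Type.
Implicit Type s : seq T.

Lemma face_cons i (a : T) s : face i.+1 (a :: s) = a :: face i s.
Proof. by []. Qed.

Lemma face0 (a : T) s : face 0 (a :: s) = s.
Proof. by rewrite /face /= drop0. Qed.

Lemma size_face i s : i < size s -> size (face i s) = (size s).-1.
Proof.
elim: s i => [|a s IHs] [|i] //; rewrite ?face0 // face_cons /= ltnS.
by move=> /[dup] si /IHs->; case: (s) si.
Qed.

Lemma map_face (U : Type) (f : T -> U) i s : map f (face i s) = face i (map f s).
Proof. by rewrite /face map_cat map_take map_drop. Qed.

Lemma face_face i j s : j <= i -> face j (face i.+1 s) = face i (face j s).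
Proof.
elim: s i j => [[|i] [|j]|a s IHs [|i] [|j]] //; rewrite !face_cons ?face0 //.
by rewrite ltnS => /IHs->.
Qed.

End Faces.

Section Chains.
Local Open Scope nat_scope.
Variable G : digraph.
Implicit Types (x y z : G) (s : seq G).

Definition is_chain s : bool :=
  (s != [::]) && sorted (fun x y => (x != y) && reachable x y) s.

(* The tuples (x_0, ..., x_k), k >= 0, spanning RC. *)
Definition chain := {s : seq G | is_chain s}.
HB.instance Definition _ := Choice.on chain.

(* On a chain no distance is infinite, and the default 0 is not used. *)
Definition len s : nat :=
  if s is x :: s' then
    sumn (pairmap (fun a b => odflt 0%N (dist a b)) x s')
  else 0.

Lemma reachable_refl x : reachable x x.
Proof. by apply/reachableP; exists [::]. Qed.

Lemma dist_path x p : path (@edge G) x p ->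
  odflt 0%N (dist x (last x p)) <= size p.
Proof.
move=> xp; rewrite /dist; case: pselect => //= h.
by case: ex_minnP => m _; apply; apply/asboolP; exists p.
Qed.

Lemma reachable_dist x y : reachable x y ->
  exists p, [/\ path (@edge G) x p, last x p = y & size p = odflt 0%N (dist x y)].
Proof.
rewrite /reachable /dist; case: pselect => //= h _.
by case: ex_minnP => m /asboolP.
Qed.

Lemma reachable_trans : transitive (@reachable G).
Proof.
move=> y x z /reachableP[p xp <-] /reachableP[q yq <-].
by apply/reachableP; exists (p ++ q); rewrite ?last_cat // cat_path xp.
Qed.

Lemma dist_triangle x y z : reachable x y -> reachable y z ->
  odflt 0%N (dist x z) <= odflt 0%N (dist x y) + odflt 0%N (dist y z).
Proof.
move=> /reachable_dist[p [xp py <-]] /reachable_dist[q [yq <- <-]].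
by rewrite -py -last_cat -size_cat dist_path // cat_path xp py.
Qed.

Lemma len_face i s : sorted (@reachable G) s -> len (face i s) <= len s.
Proof.
elim: s i => [|x s IHs] i; first by rewrite /face; case: i.
case: i => [|i].
  by rewrite face0; case: s IHs => [|y s] // _ _; rewrite /= leq_addl.
rewrite face_cons; case: s IHs => [|y s] // IHs /=.
move=> /andP[xy ys]; case: i => [|i].
  rewrite face0; case: s IHs ys => [|z s] // _ /= /andP[yz _].
  by rewrite addnA leq_add2r dist_triangle.
by rewrite face_cons /= leq_add2l; apply: (IHs i.+1).
Qed.

Lemma sorted_face i s : sorted (@reachable G) s -> sorted (@reachable G) (face i s).
Proof.
move=> h; apply: (subseq_sorted reachable_trans _ h).
rewrite -[X in subseq _ X](cat_take_drop i s) cat_subseq //.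
by rewrite -add1n -drop_drop drop_subseq.
Qed.

Lemma chain_sorted s : is_chain s -> sorted (@reachable G) s.
Proof. by case/andP=> _; apply: sub_sorted => x y /andP[]. Qed.

Lemma sorted_chainVrepeat s : sorted (@reachable G) s ->
  [\/ s = [::], is_chain s | exists u x v, s = u ++ x :: x :: v].
Proof.
elim: s => [|x s IHs]; first by constructor 1.
case: s IHs => [|y s] IHs /=; first by constructor 2.
move=> /andP[xy ys]; have [->|xNy] := eqVneq x y.
  by constructor 3; exists [::], y, s.
case: (IHs ys) => // [/andP[_ h]|[u [z [v ->]]]].
  by constructor 2; rewrite /is_chain /= xNy xy.
by constructor 3; exists (x :: u), z, v.
Qed.

Lemma repeat_is_chain u x v : is_chain (u ++ x :: x :: v) = false.
Proof.
by apply/negP => /andP[_ /cat_sorted2[_]] /=; rewrite eqxx.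
Qed.

End Chains.

Section Complex.
Variables (R : pzRingType) (G : digraph).
Implicit Types (x y : G) (s : seq G).

Definition RC_mod := freemod R (chain G).
HB.instance Definition _ := GRing.Lmodule.on RC_mod.

(* Zero on the tuples with repeated consecutive entries, and on the empty
   tuple, the only face of a tuple of degree 0. *)
Definition gen s : RC_mod :=
  if insub s is Some c then freemod_gen R (c : chain G) else 0.

Lemma gen_chain (c : chain G) : gen (val c) = freemod_gen R c.
Proof. by rewrite /gen valK. Qed.

Lemma gen_nil : gen [::] = 0.
Proof. by rewrite /gen insubF. Qed.

Lemma gen_repeat u x v : gen (u ++ x :: x :: v) = 0.
Proof. by rewrite /gen insubF // repeat_is_chain. Qed.

Definition alt_faces s : RC_mod :=
  \sum_(i < size s) (-1) ^+ i *: gen (face i s).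

Definition RC_d : {linear RC_mod -> RC_mod} :=
  freemod_lift (fun c : chain G => alt_faces (val c)).

(* F_p RC_n: the tuples have n + 1 entries and length at most p. *)
Definition RC_fil (p n : int) : submodClosed RC_mod :=
  @freemod_span R (chain G)
    (fun c => ((size (val c))%:Z == n + 1) && ((len (val c))%:Z <= p)).

Lemma alt_faces_repeat u x v : alt_faces (u ++ x :: x :: v) = 0.
Proof.
rewrite /alt_faces.
have hu : (size u < size (u ++ x :: x :: v))%N.
  by rewrite size_cat /= -addSnnS leq_addr.
have hu1 : ((size u).+1 < size (u ++ x :: x :: v))%N.
  by rewrite size_cat /= -!addSnnS leq_addr.
rewrite (bigD1 (Ordinal hu)) // (bigD1 (Ordinal hu1)) /=; last first.
  by rewrite -val_eqE /= neq_ltn ltnSn orbT.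
have -> : face (size u) (u ++ x :: x :: v) = u ++ x :: v.
  by rewrite /face take_size_cat // drop_cat ltnNge leqnSn subSnn.
have -> : face (size u).+1 (u ++ x :: x :: v) = u ++ x :: v.
  rewrite -cat_rcons -(size_rcons u x) /face take_size_cat // drop_cat.
  by rewrite ltnNge leqnSn subSnn /= drop0 cat_rcons.
rewrite exprS mulN1r scaleNr addrA subrr add0r big1 // => k.
rewrite -!val_eqE /= => /andP[ku ku1].
suff [u' [v' ->]] : exists u' v', face k (u ++ x :: x :: v) = u' ++ x :: x :: v'.
  by rewrite gen_repeat scaler0.
case: (ltngtP k (size u)) ku => // ku _.
  exists (face k u), v; rewrite /face take_cat ku drop_cat -catA; case: ltnP => //.
  move=> uk; have {}uk : size u = k.+1 by apply/eqP; rewrite eqn_leq uk ku.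
  by rewrite -uk subnn drop0 drop_size.
have {ku ku1}[m ->] : exists m, k = (size u + m.+2)%N :> nat.
  exists (k - (size u).+2)%N; rewrite !addnS -!addSn subnKC //.
  by rewrite ltn_neqAle eq_sym ku1.
exists u, (face m v).
by rewrite /face take_cat drop_cat !ltnNge -addnS !leq_addr /= !addKn -catA.
Qed.

Lemma RC_d_gen s : sorted (@reachable G) s -> RC_d (gen s) = alt_faces s.
Proof.
move/sorted_chainVrepeat => [->|cs|[u [x [v ->]]]].
- by rewrite gen_nil raddf0 /alt_faces big_ord0.
- by rewrite (gen_chain (exist _ s cs)); apply: freemod_lift_gen.
by rewrite gen_repeat raddf0 alt_faces_repeat.
Qed.

Lemma alt_faces_alt_faces s :
  \sum_(i < size s) (-1) ^+ i *: alt_faces (face i s) = 0.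
Proof.
case: s => [|a s]; first by rewrite big_ord0.
set t := a :: s; set n := size s.
pose F i j := (-1 : R) ^+ (i + j) *: gen (face j (face i t)).
have FS i j : (j <= i)%N -> F i.+1 j = - F j i.
  move=> ji; rewrite /F face_face // addSn exprS mulN1r scaleNr.
  by rewrite addnC.
transitivity (\sum_(i < n.+1) \sum_(j < n) F i j).
  apply: eq_bigr => i _; rewrite /alt_faces size_face // scaler_sumr.
  by apply: eq_bigr => j _; rewrite scalerA -exprD.
transitivity (\sum_(i < n.+1) \sum_(j < n | (j < i)%N) F i j +
              \sum_(i < n.+1) \sum_(j < n | (i <= j)%N) F i j).
  rewrite -big_split; apply: eq_bigr => i _.
  rewrite (bigID (fun j : 'I_n => (j < i)%N)) /=; congr (_ + _).
  by apply: eq_bigl => j; rewrite -leqNgt.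
have -> : \sum_(i < n.+1) \sum_(j < n | (j < i)%N) F i j =
          \sum_(i < n) \sum_(j < n | (j <= i)%N) F i.+1 j.
  by rewrite big_ord_recl [X in X + _]big1 ?add0r.
have -> : \sum_(i < n.+1) \sum_(j < n | (i <= j)%N) F i j =
          \sum_(i < n) \sum_(j < n | (j <= i)%N) F j i.
  rewrite big_ord_recr /= [X in _ + X]big1 ?addr0; last first.
    by move=> j; rewrite leqNgt ltn_ord.
  exact: (exchange_big_dep predT).
rewrite -big_split big1 // => i _ /=; rewrite -big_split big1 // => j ji /=.
by rewrite FS // addNr.
Qed.

Fact RC_dd (z : RC_mod) : RC_d (RC_d z) = 0.
Proof.
have h (c : chain G) : RC_d (alt_faces (val c)) = 0.
  rewrite [X in RC_d X]/alt_faces linear_sum.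
  rewrite -[RHS](alt_faces_alt_faces (val c)); apply: eq_bigr => i _.
  by rewrite linearZ /= RC_d_gen // sorted_face // chain_sorted // valP.
rewrite -[RC_d z]/(\sum_(c <- msupp z) z@_c *: alt_faces (val c)).
by rewrite linear_sum big1 // => c _; rewrite linearZ /= h scaler0.
Qed.

Lemma RC_fil_gen p n s : (size s)%:Z = n + 1 -> (len s)%:Z <= p ->
  gen s \in RC_fil p n.
Proof.
move=> sn sp; rewrite /gen; case: insubP => [c _ cs|_]; last exact: rpred0.
by apply: freemod_span_gen; rewrite cs sn eqxx.
Qed.

Fact RC_fil_incl p n (z : RC_mod) : z \in RC_fil p n -> z \in RC_fil (p + 1) n.
Proof.
rewrite !inE => /asboolP h; apply/asboolP => k /h /andP[-> /=].
by move/le_trans; apply; rewrite lerDl.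
Qed.

Fact RC_fil_d p n (z : RC_mod) : z \in RC_fil p n -> RC_d z \in RC_fil p (n - 1).
Proof.
apply: freemod_span_lift => c /andP[/eqP cn cp].
apply: rpred_sum => i _; apply/rpredZ/RC_fil_gen.
  rewrite size_face // subrK; apply: (addIr 1); rewrite -cn.
  by case: (size _) i => [[]|m _] //=; rewrite -addn1.
apply: le_trans cp; rewrite lez_nat; apply/len_face/chain_sorted/valP.
Qed.

Definition RC : filteredComplex R := FilteredComplex RC_dd RC_fil_incl RC_fil_d.

End Complex.

Section ComplexMap.
Variables (R : pzRingType) (G H : digraph) (f : dihom G H).

Definition RC_map : {linear RC_mod R G -> RC_mod R H} :=
  freemod_lift (fun c : chain G => gen R (map f (val c))).

Lemma dihom_path (x : G) p : path (@edge G) x p ->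
  exists q, [/\ path (@edge H) (f x) q, last (f x) q = f (last x p) &
                (size q <= size p)%N].
Proof.
elim: p x => [|y p IHp] x; first by exists [::].
move=> /= /andP[xy /IHp[q [yq ql qp]]]; case: (dihomP f xy) => fxy.
  by exists q; rewrite fxy; split=> //; apply: leqW.
by exists (f y :: q); rewrite /= fxy.
Qed.

Lemma dihom_reachable x y : reachable x y -> reachable (f x) (f y).
Proof.
by move=> /reachableP[p /dihom_path[q [fq ql _]] <-]; apply/reachableP; exists q.
Qed.

Lemma dihom_dist x y : reachable x y ->
  (odflt 0%N (dist (f x) (f y)) <= odflt 0%N (dist x y))%N.
Proof.
move=> /reachable_dist[p [/dihom_path[q [fq ql qp]] <- <-]].
by rewrite -ql (leq_trans (dist_path fq)).
Qed.

Lemma dihom_sorted s :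
  sorted (@reachable G) s -> sorted (@reachable H) (map f s).
Proof. by rewrite sorted_map; apply: sub_sorted => x y /dihom_reachable. Qed.

Lemma dihom_len s : sorted (@reachable G) s -> (len (map f s) <= len s)%N.
Proof.
elim: s => [|x [|y s] IHs] //= /andP[xy ys].
by rewrite leq_add ?dihom_dist // IHs.
Qed.

Lemma RC_map_gen s : sorted (@reachable G) s -> RC_map (gen R s) = gen R (map f s).
Proof.
move/sorted_chainVrepeat => [->|cs|[u [x [v ->]]]].
- by rewrite !gen_nil raddf0.
- by rewrite (gen_chain R (exist _ s cs)); apply: freemod_lift_gen.
by rewrite map_cat /= !gen_repeat raddf0.
Qed.

Fact RC_map_d z : RC_map (RC_d R G z) = RC_d R H (RC_map z).
Proof.
rewrite -[RC_d R G z]/(\sum_(c <- msupp z) z@_c *: alt_faces R (val c)).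
rewrite -[RC_map z]/(\sum_(c <- msupp z) z@_c *: gen R (map f (val c))).
rewrite [LHS]linear_sum [RHS]linear_sum; apply: eq_bigr => c _.
rewrite [LHS]linearZ [RHS]linearZ /=; congr (_ *: _).
have cs := chain_sorted (valP c).
rewrite (RC_d_gen R (dihom_sorted cs)) /alt_faces size_map [LHS]linear_sum.
apply: eq_bigr => i _; rewrite [LHS]linearZ -map_face; congr (_ *: _).
exact/RC_map_gen/sorted_face.
Qed.

Fact RC_map_fil p n z : z \in RC_fil R G p n -> RC_map z \in RC_fil R H p n.
Proof.
apply: freemod_span_lift => c /andP[/eqP cn cp].
apply: RC_fil_gen; first by rewrite size_map.
by apply: le_trans cp; rewrite lez_nat dihom_len // chain_sorted ?valP.
Qed.

Definition RC_fmap : filteredMap (RC R G) (RC R H) :=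
  @FilteredMap R (RC R G) (RC R H) RC_map RC_map_d RC_map_fil.

End ComplexMap.

(** * Bigraded path homology *)

Definition PH (R : comPzRingType) (G : digraph) (k l : int) : lmodType R :=
  page (RC R G) 2 l (k - l).

Definition PH_map (R : comPzRingType) (G H : digraph) (f : dihom G H)
    (k l : int) : {linear PH R G k l -> PH R H k l} :=
  page_map (RC_fmap R f) 2 l (k - l).

Definition exact_at (R : pzRingType) (U V W : lmodType R)
    (f : U -> V) (g : V -> W) : Prop :=
  forall v, g v = 0 <-> exists u, f u = v.

(* Main.v *)
From HB Require Import structures.
Require Import Defs.
From mathcomp Require Import all_boot all_order all_algebra finmap.
From mathcomp Require Import boolp monalg zify.

(* Let pi be the projection of the reach of A onto A and k its counterpart for
   Y in P = X \cup_A Y. The prism operator K between pi and the identity does not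
   increase the length of a chain once the distance d(pi x_0, x_0) is added to
   it. Since a chain of P is a list of vertices of Y followed by a list of
   vertices of X outside A, this gives maps that respect the length filtration
     q : RC(P) -> RC(X),   r : RC(P) -> RC(Y),   s : RC(P) -> RC(A),
   which send (y_0, ..., y_m, x_0, ..., x_n) to
     q = K(x_0, ..., x_n) and s = (pi x_0, ..., pi x_n) if m = 0, q = s = 0 if
     m > 0, and q = identity, s = 0 on the chains without vertices in Y;
     r = (y_0, ..., y_m, k x_0, ..., k x_n), and 0 on the latter chains.
   They satisfy d q - q d = - i s and d r - r d = f s, that is, (q, r, s) is a
   chain map to the mapping cone of (i, - f), and g q + j r is homotopic to the
   identity. Moreover s lowers the length, because x_n is at positive distance
   from pi x_n, so that it induces the connecting map on the second page, and
   exactness is checked directly on the cycles and boundaries defining this page. *)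

Set Implicit Arguments.
Unset Strict Implicit.
Unset Printing Implicit Defensive.

Import Order.TTheory GRing.Theory Num.Theory.
Local Open Scope ring_scope.

(** * Lists of vertices and the prism operator *)

(* Decides equalities of abelian groups: the right-hand side is moved to the
   left and opposite terms are brought next to each other and cancelled. *)
Ltac zmod_cancel :=
  match goal with
  | |- _ + - ?y = 0 => let x := fresh in move: (y) => x;
      repeat match goal with
      | |- context [?u + x + ?z] =>
          lazymatch z with x => fail | _ => rewrite (addrAC u x z) end
      end; rewrite (subrK x); try clear x
  | |- _ + ?y = 0 => let x := fresh in move: (y) => x;
      repeat match goal with
      | |- context [?u + - x + ?z] =>
          lazymatch z with - x => fail | _ => rewrite (addrAC u (- x) z) end
      end; rewrite (addrK x); try clear x
  end.
Ltac zmod :=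
  apply: subr0_eq; rewrite -[LHS]add0r;
  rewrite ?(opprB, opprD, opprK, oppr0, addrA, addr0, subr0);
  repeat zmod_cancel; reflexivity.

(** * Submodules and free modules *)

Section SubmodTheory.
Variables (R : pzRingType) (V : lmodType R) (W : submodClosed V).

Lemma submodN x : x \in W -> - x \in W.
Proof. by move=> xW; rewrite -scaleN1r rpredZ. Qed.

Lemma submodB x y : x \in W -> y \in W -> x - y \in W.
Proof. by move=> xW yW; rewrite rpredD // submodN. Qed.

End SubmodTheory.

Record free_lmod (R : pzRingType) (K : choiceType) := FreeLmod {
  flmod_carrier :> lmodType R;
  flmod_gen : K -> flmod_carrier;
  flmod_lift : forall V : lmodType R, (K -> V) -> {linear flmod_carrier -> V};
  flmod_span : pred K -> submodClosed flmod_carrier;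
  flmod_lift_gen : forall (V : lmodType R) (h : K -> V) k,
    flmod_lift h (flmod_gen k) = h k;
  flmod_span_gen : forall (S : pred K) k, S k -> flmod_gen k \in flmod_span S;
  flmod_span_all : forall x, x \in flmod_span xpredT;
  flmod_span_linear : forall (V : lmodType R) (h : {linear flmod_carrier -> V})
      (S : pred K) (W : submodClosed V) x,
    (forall k, S k -> h (flmod_gen k) \in W) -> x \in flmod_span S -> h x \in W;
  flmod_span_eq : forall (V : lmodType R) (h h' : {linear flmod_carrier -> V})
      (S : pred K) x,
    (forall k, S k -> h (flmod_gen k) = h' (flmod_gen k)) ->
    x \in flmod_span S -> h x = h' x }.

(* Unification in the concrete module [freemod R K] is prohibitively slow, hence
   the opaque proof: only the interface above is ever used. *)
Definition the_free_lmod (R : pzRingType) (K : choiceType) : free_lmod R K.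
Proof.
apply: (@FreeLmod R K (freemod R K) (@freemod_gen R K)
  (fun V h => @freemod_lift R K V h) (@freemod_span R K)) => /=.
- by move=> V h k; apply: freemod_lift_gen.
- by move=> S k Sk; apply: freemod_span_gen.
- by move=> x; rewrite inE; apply/asboolP.
- move=> V h S W x hW; rewrite inE => /asboolP xS.
  rewrite [x]freemodE (linear_sum h) big_seq.
  by apply: rpred_sum => k /xS Sk; rewrite (linearZ_LR h) rpredZ // hW.
move=> V h h' S x hh'; rewrite inE => /asboolP xS.
rewrite [x]freemodE (linear_sum h) (linear_sum h') !big_seq.
apply: eq_bigr => k /xS Sk.
by rewrite (linearZ_LR h) (linearZ_LR h') hh'.
Qed.

Section FreeLmoduleTheory.
Variables (R : pzRingType) (K : choiceType) (V : lmodType R).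
Local Notation F := (the_free_lmod R K).

Lemma lmod_span_sub (S S' : pred K) (x : F) :
  (forall k, S k -> S' k) -> x \in flmod_span F S -> x \in flmod_span F S'.
Proof.
move=> SS'; apply: (flmod_span_linear (h := idfun)) => k /SS' /=.
exact: flmod_span_gen.
Qed.

Lemma lmod_eq (h h' : {linear F -> V}) :
  (forall k, h (flmod_gen F k) = h' (flmod_gen F k)) -> h =1 h'.
Proof.
by move=> hh' x; apply: (flmod_span_eq (S := xpredT)) (flmod_span_all x).
Qed.

End FreeLmoduleTheory.

Section Words.
Variable R : pzRingType.
Local Notation T V := (the_free_lmod R (seq V)).
Local Notation "[< s >]" := (flmod_gen (T _) s).

(** * The augmented boundary on lists *)

Section Boundary.
Variable V : choiceType.
Implicit Types (v : V) (s : seq V) (t : T V).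

Definition wcons v : T V -> T V := flmod_lift (T _) (fun s => [< v :: s >]).
HB.instance Definition _ v := GRing.Linear.on (wcons v).

Lemma wcons_gen v s : wcons v [< s >] = [< v :: s >].
Proof. exact: flmod_lift_gen. Qed.

Definition wbd : T V -> T V :=
  flmod_lift (T _) (fun s => \sum_(i < size s) (-1) ^+ i *: [< face i s >]).
HB.instance Definition _ := GRing.Linear.on wbd.

Lemma wbd_gen s : wbd [< s >] = \sum_(i < size s) (-1) ^+ i *: [< face i s >].
Proof. exact: flmod_lift_gen. Qed.

Lemma wbd_nil : wbd [< [::] >] = 0.
Proof. by rewrite wbd_gen big_ord0. Qed.

(** Keeping lists with repetitions, and the empty list as the face of a one-entry list, frees this
    recursion of exceptions, so that later identities follow by induction on the list. *)
Lemma wbd_cons_gen v s : wbd [< v :: s >] = [< s >] - wcons v (wbd [< s >]).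
Proof.
rewrite !wbd_gen /= big_ord_recl face0 expr0 scale1r [wcons v _]linear_sum -sumrN.
congr (_ + _); apply: eq_bigr => i _.
by rewrite face_cons linearZ /= wcons_gen exprS mulN1r scaleNr.
Qed.

Lemma wbd_cons v t : wbd (wcons v t) = t - wcons v (wbd t).
Proof.
apply: (@lmod_eq _ _ _ (wbd \o wcons v) (idfun \- (wcons v \o wbd))).
by move=> s /=; rewrite wcons_gen wbd_cons_gen.
Qed.

Lemma wbdK t : wbd (wbd t) = 0.
Proof.
apply: (@lmod_eq _ _ _ (wbd \o wbd) (\0 : {linear T V -> T V})) => s /=.
elim: s => [|v s IHs]; first by rewrite wbd_nil raddf0.
by rewrite wbd_cons_gen linearB /= wbd_cons IHs raddf0 subr0 subrr.
Qed.

Definition face_closed (S : pred (seq V)) := forall i s, S s -> S (face i s).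

Lemma all_face_closed (Q : pred V) : face_closed (all Q).
Proof.
move=> i s /allP Qs; apply/allP => v; rewrite /face mem_cat.
by move=> /orP[/mem_take|/mem_drop] /Qs.
Qed.

Lemma wbd_span (S : pred (seq V)) t : face_closed S ->
  t \in flmod_span (T _) S -> wbd t \in flmod_span (T _) S.
Proof.
move=> Sf; apply: flmod_span_linear => s /= Ss; rewrite wbd_gen.
by apply: rpred_sum => i _; apply/rpredZ/flmod_span_gen/Sf.
Qed.

End Boundary.

Section Map.
Variables (V W : choiceType) (phi : V -> W).
Implicit Types (s : seq V) (t : T V).

Definition wmap : T V -> T W := flmod_lift (T _) (fun s => [< map phi s >]).
HB.instance Definition _ := GRing.Linear.on wmap.

Lemma wmap_gen s : wmap [< s >] = [< map phi s >].
Proof. exact: flmod_lift_gen. Qed.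

Lemma wmap_cons v t : wmap (wcons v t) = wcons (phi v) (wmap t).
Proof.
apply: (@lmod_eq _ _ _ (wmap \o wcons v) (wcons (phi v) \o wmap)).
by move=> s /=; rewrite wcons_gen !wmap_gen wcons_gen.
Qed.

Lemma wmap_bd t : wmap (wbd t) = wbd (wmap t).
Proof.
apply: (@lmod_eq _ _ _ (wmap \o @wbd V) (@wbd W \o wmap)) => s /=.
rewrite wmap_gen !wbd_gen size_map linear_sum; apply: eq_bigr => i _.
by rewrite linearZ /= wmap_gen map_face.
Qed.

(* The inverse of [map phi] is zero outside the image rather than given by a
   default value, since V may be empty. *)
Variable V0 : pred V.

Definition winv : T W -> T V := flmod_lift (T _) (fun w =>
  if pselect (exists2 s, all V0 s & map phi s = w) is left h
  then [< s2val (cid2 h) >] else 0).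
HB.instance Definition _ := GRing.Linear.on winv.

Hypothesis phi_inj : {in V0 &, injective phi}.

Lemma winv_gen s : all V0 s -> winv [< map phi s >] = [< s >].
Proof.
move=> V0s; rewrite [LHS]flmod_lift_gen.
case: pselect => [h|[]]; last by exists s.
case: cid2 => s' /= V0s' /(inj_in_map phi_inj) -> //; exact/allP.
Qed.

Lemma winv_map t : t \in flmod_span (T _) (all V0) -> winv (wmap t) = t.
Proof.
apply: (@flmod_span_eq _ _ _ _ (winv \o wmap) idfun) => s /= V0s.
by rewrite wmap_gen winv_gen.
Qed.

(** The restriction to words coming from V0 matters: [winv] kills a list outside the image, although
    some of its faces may lie in the image. *)
Lemma winv_bd t : t \in flmod_span (T _) (all V0) ->
  winv (wbd (wmap t)) = wbd (winv (wmap t)).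
Proof.
move=> V0t; rewrite -wmap_bd !winv_map // wbd_span //.
exact: all_face_closed.
Qed.

End Map.

(** * The prism homotopy *)

Section Prism.
Variables (V : choiceType) (k : V -> V).
Implicit Types (s : seq V) (t : T V).

(* The classical prism
     (x_0, ..., x_n) |->
       \sum_i (-1)^i (k x_0, ..., k x_i, x_i, ..., x_n). *)
Fixpoint prism_word s : T V :=
  if s is x :: s' then [< k x :: x :: s' >] - wcons (k x) (prism_word s') else 0.

Definition prism : T V -> T V := flmod_lift (T _) prism_word.
HB.instance Definition _ := GRing.Linear.on prism.

Lemma prism_nil : prism [< [::] >] = 0.
Proof. exact: flmod_lift_gen. Qed.

Lemma prism_cons_gen v s :
  prism [< v :: s >] = [< k v :: v :: s >] - wcons (k v) (prism [< s >]).
Proof. by rewrite /prism !flmod_lift_gen. Qed.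

Lemma prism_cons v t :
  prism (wcons v t) = wcons (k v) (wcons v t) - wcons (k v) (prism t).
Proof.
apply: (@lmod_eq _ _ _ (prism \o wcons v)
  ((wcons (k v) \o wcons v) \- (wcons (k v) \o prism))) => s /=.
by rewrite !wcons_gen prism_cons_gen.
Qed.

Lemma prism_bd t : wbd (prism t) + prism (wbd t) = t - wmap k t.
Proof.
apply: (@lmod_eq _ _ _ ((@wbd V \o prism) \+ (prism \o @wbd V))
  (idfun \- wmap k)) => s /=.
elim: s => [|v s IHs].
  by rewrite prism_nil wbd_nil !raddf0 addr0 wmap_gen subrr.
rewrite prism_cons_gen wbd_cons_gen !linearB /= prism_cons.
rewrite -!wcons_gen !wbd_cons wmap_cons.
(* The induction hypothesis is solved for the image word; what remains is an identity of abelian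
   groups. *)
have -> : wmap k [< s >] =
    [< s >] - wbd (prism [< s >]) - prism (wbd [< s >]).
  by rewrite -addrA -opprD IHs opprB addrC subrK.
rewrite !(linearB (wcons (k v))) /=; zmod.
Qed.

End Prism.

(** * Lists starting in Q, and how faces leave Q *)

Section Crossing.
Variables (V : choiceType) (Q : pred V).
Implicit Types (s : seq V) (t : T V).

Definition starts s : bool := if s is x :: _ then Q x else false.

Definition wstart : T V -> T V :=
  flmod_lift (T _) (fun s => if starts s then [< s >] else 0).
HB.instance Definition _ := GRing.Linear.on wstart.

Lemma wstart_gen s : wstart [< s >] = if starts s then [< s >] else 0.
Proof. exact: flmod_lift_gen. Qed.

Lemma wstart_cons x t : Q x -> wstart (wcons x t) = wcons x t.
Proof.
move=> Qx; apply: (@lmod_eq _ _ _ (wstart \o wcons x) (wcons x)) => s /=.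
by rewrite wcons_gen wstart_gen /= Qx.
Qed.

(* The part of the boundary of the lists starting in Q which leaves Q. *)
Definition wcross : T V -> T V :=
  (@wbd V \o wstart) \- (wstart \o (@wbd V \o wstart)).
HB.instance Definition _ := GRing.Linear.on wcross.

Lemma wcrossE t : wcross t = wbd (wstart t) - wstart (wbd (wstart t)).
Proof. by []. Qed.

(** Every face except the one deleting the head keeps the first vertex, so only that face can stop
    starting in Q. *)
Lemma wcross_gen x s :
  wcross [< x :: s >] = if Q x && ~~ starts s then [< s >] else 0.
Proof.
rewrite wcrossE wstart_gen /=; case: ifP => Qx /=; last by rewrite !raddf0 addr0.
rewrite wbd_cons_gen linearB /= wstart_cons // wstart_gen.
by case: ifP => _ /=; rewrite ?subrr // sub0r opprK subrK.
Qed.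

Lemma wcross_nil : wcross [< [::] >] = 0.
Proof. by rewrite wcrossE wstart_gen /= !raddf0 addr0. Qed.

Lemma wstart_out t : t \in flmod_span (T _) (all (predC Q)) -> wstart t = 0.
Proof.
apply: (@flmod_span_eq _ _ _ _ wstart \0) => -[|x s] /=.
  by rewrite wstart_gen.
by move=> /andP[/negPf Qx _]; rewrite wstart_gen /= Qx.
Qed.

(* S stands for the chains of a digraph, which never come back to Q. *)
Variable S : pred (seq V).
Hypothesis S_face : face_closed S.
Hypothesis S_out : forall s, S s -> ~~ starts s -> all (predC Q) s.

Lemma wstart_out_span t : t \in flmod_span (T _) S ->
  t - wstart t \in flmod_span (T _) (predI S (all (predC Q))).
Proof.
apply: (flmod_span_linear (h := idfun \- wstart)) => s Ss /=.
rewrite wstart_gen; case: ifPn => [_|/(S_out Ss) sQ]; first by rewrite subrr rpred0.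
by rewrite subr0 flmod_span_gen //= Ss.
Qed.

Lemma wstart_span (Z : pred (seq V)) t : (forall s, S s -> starts s -> Z s) ->
  t \in flmod_span (T _) S -> wstart t \in flmod_span (T _) Z.
Proof.
move=> SZ; apply: flmod_span_linear => s Ss /=; rewrite wstart_gen.
by case: ifPn => [/(SZ _ Ss)|_]; [exact: flmod_span_gen | exact: rpred0].
Qed.

(** By [S_out], what [wstart] discards from t is made of lists avoiding Q. Their faces avoid Q too
    and are killed by [wstart], so only the boundary of [wstart t] counts, less the part that leaves
    Q. *)
Lemma wstart_bd t : t \in flmod_span (T _) S ->
  wstart (wbd t) = wbd (wstart t) - wcross t.
Proof.
move=> tS; have vS := wstart_out_span tS.
have : wstart (wbd (t - wstart t)) = 0.
  apply/wstart_out/wbd_span; first exact: all_face_closed.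
  by apply: lmod_span_sub vS => s /andP[].
rewrite linearB linearB /= => /subr0_eq ->.
by rewrite wcrossE opprB addrC subrK.
Qed.

(** The lists in [wcross t] are faces of lists starting in Q, hence inherit Z. In the application Q
    is Y and Z is the reach of Y. *)
Lemma wcross_span (Z : pred V) t : (forall s, S s -> starts s -> all Z s) ->
  t \in flmod_span (T _) S ->
  wcross t \in flmod_span (T _) (predI S (all (predI Z (predC Q)))).
Proof.
move=> SZ tS; pose S' := predI S (all Z).
have uS : wstart t \in flmod_span (T _) S'.
  by apply: wstart_span tS => s Ss Qs; rewrite /S' /= Ss SZ.
have {}uS : wbd (wstart t) \in flmod_span (T _) S'.
  apply: wbd_span uS => i s /andP[Ss Zs].
  by rewrite /S' /= S_face // all_face_closed.
move: uS; rewrite wcrossE; move: (wbd _) => u.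
apply: (flmod_span_linear (h := idfun \- wstart)) => s /andP[Ss Zs] /=.
rewrite wstart_gen; case: ifPn => [_|/(S_out Ss) sQ]; first by rewrite subrr rpred0.
by rewrite subr0 flmod_span_gen //= Ss all_predI Zs.
Qed.

(** Since the boundary squares to zero, [wstart_bd] leaves only the boundary of [- wcross t]. It
    consists of lists avoiding Q, so the [wstart] term of [wcross] vanishes on it. *)
Lemma wcross_bd t : t \in flmod_span (T _) S -> wcross (wbd t) = - wbd (wcross t).
Proof.
move=> tS; rewrite [LHS]wcrossE wstart_bd //.
have -> : wbd (wbd (wstart t) - wcross t) = - wbd (wcross t).
  by rewrite linearB /= wbdK add0r.
rewrite linearN /= wstart_out ?oppr0 ?addr0 //; apply: wbd_span.
  exact: all_face_closed.
apply: lmod_span_sub (@wcross_span xpredT t _ tS) => [s /andP[_ //]|s _ _].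
exact: all_predT.
Qed.

End Crossing.

(** * Degenerate lists, which become zero in the reachability complex *)

Section Repetitions.

Definition rep (V : eqType) : pred (seq V) :=
  fun s => ~~ sorted (fun x y => x != y) s.

Variables V W : choiceType.
Implicit Types (s : seq V) (t : T V).
Local Notation span_rep := (flmod_span (T _) (@rep _)).

Lemma wcons_rep v t : t \in span_rep -> wcons v t \in span_rep.
Proof.
apply: flmod_span_linear => s /= sr; rewrite wcons_gen.
apply: flmod_span_gen; case: s sr => //= w s.
by rewrite /rep /= negb_and => ->; rewrite orbT.
Qed.

Lemma wcons2_rep v t : wcons v (wcons v t) \in span_rep.
Proof.
move: (flmod_span_all t).
apply: (flmod_span_linear (h := wcons v \o wcons v)) => s _ /=.
by rewrite !wcons_gen; apply: flmod_span_gen; rewrite /rep /= eqxx.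
Qed.

Lemma prism_rep (k : V -> V) t : t \in span_rep -> prism k t \in span_rep.
Proof.
apply: flmod_span_linear => s /=; elim: s => // v s IHs vs.
have h : [< k v :: v :: s >] \in span_rep.
  apply: flmod_span_gen; apply: contraNN vs => /=; case/andP=> _; exact.
rewrite prism_cons_gen submodB //.
case: s vs IHs h => // w s /=; rewrite {1}/rep /= negb_and negbK.
move=> /orP[/eqP<-|ws] IHs h; last by apply/wcons_rep/IHs.
(* For a list starting with v, v, unfolding once more leaves a list starting with k v, k v and the
   double prefix k v, k v of a prism: both are degenerate. *)
rewrite prism_cons_gen linearB /= !wcons_gen submodB //.
  by apply: flmod_span_gen; rewrite /rep /= eqxx.
exact: wcons2_rep.
Qed.

Lemma wmap_rep (phi : V -> W) t : t \in span_rep -> wmap phi t \in span_rep.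
Proof.
apply: flmod_span_linear => s /= sr; rewrite wmap_gen.
apply: flmod_span_gen; apply: contraNN sr; rewrite sorted_map.
by apply: sub_sorted => x y /=; apply: contraNneq => ->.
Qed.

Lemma winv_rep (phi : V -> W) (V0 : pred V) (t : T W) :
  {in V0 &, injective phi} -> t \in span_rep -> winv phi V0 t \in span_rep.
Proof.
move=> phi_inj; apply: flmod_span_linear => s /= sr; rewrite flmod_lift_gen.
case: pselect => [h|_]; last exact: rpred0.
case: cid2 => {h} s' /= V0s' s'E; apply: flmod_span_gen; apply: contraNN sr.
rewrite -s'E sorted_map; apply: sub_in_sorted V0s' => x y xV yV.
by apply: contraNN => /eqP/phi_inj->.
Qed.

Lemma wstart_rep (Q : pred V) t : t \in span_rep -> wstart Q t \in span_rep.
Proof.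
apply: flmod_span_linear => s /= sr; rewrite wstart_gen.
by case: ifP => _; [apply: flmod_span_gen|apply: rpred0].
Qed.

(** When the head is deleted it lies in Q and its successor does not, so these two differ and the
    repetition survives in the tail. *)
Lemma wcross_rep (Q : pred V) t : t \in span_rep -> wcross Q t \in span_rep.
Proof.
apply: flmod_span_linear => -[|x s] //= sr; rewrite wcross_gen.
case: ifPn => [|_]; last exact: rpred0.
case: s sr => // y s; rewrite /rep /= => sr /andP[Qx Qy].
apply: flmod_span_gen; apply: contraNN sr => /= ->; rewrite andbT.
by apply: contraNneq Qy => <-.
Qed.

End Repetitions.
End Words.

(** * From lists to chains *)

Section WordChains.
Variables (R : pzRingType) (G : digraph).
Local Notation T := (the_free_lmod R (seq G)).
Local Notation "[< s >]" := (flmod_gen T s).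
Local Notation C := (RC R G).
Implicit Types (s : seq G) (t : T) (z : C).

Definition rsorted : pred (seq G) := sorted (@reachable G).

(* The empty word, which is zero in the reachability complex, is given every
   degree and every length. *)
Definition word_fil (p n : int) : pred (seq G) := fun s =>
  rsorted s && ((s == [::]) || ((size s)%:Z == n + 1) && ((len s)%:Z <= p)).

Definition word_chain : {linear T -> C} := flmod_lift T (@gen R G : seq G -> C).

(** A linear section of [word_chain], not a chain map: the faces of a chain may be degenerate or
    empty. *)
Definition chain_word : {linear C -> T} :=
  @freemod_lift R (chain G) T (fun c : chain G => [< val c >]).

Lemma word_chain_gen s : word_chain [< s >] = gen R s.
Proof. exact: flmod_lift_gen. Qed.

Lemma chain_word_gen s : is_chain s -> chain_word (gen R s) = [< s >].
Proof.
move=> cs; rewrite (gen_chain R (exist _ s cs)).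
exact: (@freemod_lift_gen R (chain G) T).
Qed.

Lemma chain_wordK z : word_chain (chain_word z) = z.
Proof.
rewrite -[chain_word z]/(\sum_(c <- msupp z) z@_c *: [< val c >]).
rewrite (linear_sum word_chain) [RHS]freemodE; apply: eq_bigr => c _.
by rewrite (linearZ_LR word_chain) word_chain_gen gen_chain.
Qed.

Lemma chain_word_fil p n z :
  z \in fil C p n -> chain_word z \in flmod_span T (word_fil p n).
Proof.
apply: (@freemod_span_lift R (chain G) T) => c /andP[cn cp].
apply: flmod_span_gen.
by rewrite /word_fil /rsorted chain_sorted ?valP // cn cp orbT.
Qed.

Lemma chain_word_sorted z : chain_word z \in flmod_span T rsorted.
Proof.
rewrite -[chain_word z]/(\sum_(c <- msupp z) z@_c *: [< val c >]).
apply: rpred_sum => c _; apply/rpredZ/flmod_span_gen/chain_sorted/valP.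
Qed.

Lemma word_chain_fil p n t :
  t \in flmod_span T (word_fil p n) -> word_chain t \in fil C p n.
Proof.
apply: flmod_span_linear => s /andP[_]; rewrite word_chain_gen.
case/orP => [/eqP->|/andP[/eqP sn sp]]; first by rewrite gen_nil rpred0.
exact: RC_fil_gen.
Qed.

Lemma word_chain_rep t : t \in flmod_span T (@rep G) -> word_chain t = 0.
Proof.
apply: (@flmod_span_eq _ _ _ _ word_chain \0) => s sr /=.
rewrite word_chain_gen /gen insubF //; apply: contraNF sr => /andP[_].
by apply: sub_sorted => x y /andP[].
Qed.

Lemma word_chain_nil : word_chain [< [::] >] = 0.
Proof. by rewrite word_chain_gen gen_nil. Qed.

Lemma word_chain_d t :
  t \in flmod_span T rsorted -> fc_d C (word_chain t) = word_chain (wbd t).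
Proof.
apply: (@flmod_span_eq _ _ _ _ (fc_d C \o word_chain) (word_chain \o @wbd R G)).
move=> s ss /=; rewrite word_chain_gen wbd_gen (linear_sum word_chain).
rewrite [LHS]RC_d_gen //; apply: eq_bigr => i _.
by rewrite (linearZ_LR word_chain) word_chain_gen.
Qed.

Lemma rsorted_face : face_closed rsorted.
Proof. by move=> i s; apply: sorted_face. Qed.

Lemma rsorted_bd t : t \in flmod_span T rsorted -> wbd t \in flmod_span T rsorted.
Proof. exact/wbd_span/rsorted_face. Qed.

Lemma word_fil_sorted p n t :
  t \in flmod_span T (word_fil p n) -> t \in flmod_span T rsorted.
Proof. by apply: lmod_span_sub => s /andP[]. Qed.

Lemma word_fil_le p p' n t : p <= p' ->
  t \in flmod_span T (word_fil p n) -> t \in flmod_span T (word_fil p' n).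
Proof.
move=> pp'; apply: lmod_span_sub => s /andP[ss]; rewrite /word_fil ss /=.
by case/orP => [->//|/andP[-> /le_trans->//]]; rewrite orbT.
Qed.

End WordChains.

(** * Operators on lists and the operators they induce on chains *)

Section WordMap.
Variables (R : pzRingType) (G H : digraph).
Local Notation T G := (the_free_lmod R (seq G)).
Local Notation "[< s >]" := (flmod_gen (T _) s).

Lemma word_chain_map (f : dihom G H) t : t \in flmod_span (T G) (@rsorted G) ->
  RC_fmap R f (word_chain R G t) = word_chain R H (wmap f t).
Proof.
apply: (@flmod_span_eq _ _ _ _ (RC_fmap R f \o word_chain R G)
  (word_chain R H \o wmap f)) => s ss /=.
by rewrite wmap_gen !word_chain_gen [LHS]RC_map_gen.
Qed.

(** The conditions under which an operator on lists descends to the reachability complexes, shifting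
    filtration by dp and degree by dn. The empty list is treated apart because its length and size
    carry no information. *)
Record word_op (Phi : {linear T G -> T H}) (dp dn : int) : Prop := WordOp {
  word_op_fil : forall s, rsorted s ->
    Phi [< s >] \in
      flmod_span (T H) (word_fil ((len s)%:Z + dp) ((size s)%:Z - 1 + dn));
  word_op_rep : forall t, t \in flmod_span (T G) (@rep G) ->
    Phi t \in flmod_span (T H) (@rep H);
  word_op_nil : Phi [< [::] >] = 0 \/ Phi [< [::] >] = [< [::] >] }.

Definition RC_op (Phi : {linear T G -> T H}) : {linear RC R G -> RC R H} :=
  word_chain R H \o (Phi \o chain_word R G).

Variables (Phi : {linear T G -> T H}) (dp dn : int).
Hypothesis Phi_op : word_op Phi dp dn.

Lemma word_op_sorted t : t \in flmod_span (T G) (@rsorted G) ->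
  Phi t \in flmod_span (T H) (@rsorted H).
Proof.
by apply: flmod_span_linear => s /(word_op_fil Phi_op); apply: word_fil_sorted.
Qed.

(** A sorted list is a chain, empty or degenerate; in the last two cases both sides vanish. This
    transports identities between operators from lists to chains. *)
Lemma RC_op_word t : t \in flmod_span (T G) (@rsorted G) ->
  RC_op Phi (word_chain R G t) = word_chain R H (Phi t).
Proof.
apply: (@flmod_span_eq _ _ _ _ (RC_op Phi \o word_chain R G)
  (word_chain R H \o Phi)) => s ss /=.
have [cs|Ncs] := boolP (is_chain s).
  by rewrite word_chain_gen chain_word_gen.
have [->|s0] := eqVneq s [::].
  rewrite word_chain_nil !raddf0.
  by case: (word_op_nil Phi_op) => ->; rewrite ?raddf0 ?word_chain_nil.
have sr : [< s >] \in flmod_span (T G) (@rep G).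
  apply: flmod_span_gen; apply: contraNN Ncs => sr; rewrite /is_chain s0 /=.
  elim: s ss sr {s0} => [|x [|y s] IHs] //= /andP[xy ss] /andP[-> sr].
  by rewrite xy; apply: IHs.
by rewrite (word_chain_rep sr) !raddf0 (word_chain_rep (word_op_rep Phi_op sr)).
Qed.

Lemma RC_op_fil p n z :
  z \in fil (RC R G) p n -> RC_op Phi z \in fil (RC R H) (p + dp) (n + dn).
Proof.
move=> /chain_word_fil zF; rewrite /RC_op /=; apply: word_chain_fil.
apply: flmod_span_linear zF => s /andP[ss].
case/orP => [/eqP->|/andP[/eqP sn sp]].
  case: (word_op_nil Phi_op) => ->; first exact: rpred0.
  exact: flmod_span_gen.
have := word_op_fil Phi_op ss; rewrite sn addrK; apply: word_fil_le.
by rewrite lerD2r.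
Qed.

End WordMap.

(** * Distances and contractions *)

Section NatDistance.
Local Open Scope nat_scope.

(** Infinite distance becomes 0, so inequalities between values of [ndist] go together with
    reachability assumptions. *)
Definition ndist (G : digraph) (x y : G) : nat := odflt 0 (dist x y).

Lemma ndist_triangle (G : digraph) (x y z : G) :
  reachable x y -> reachable y z -> ndist x z <= ndist x y + ndist y z.
Proof. exact: dist_triangle. Qed.

Lemma ndistxx (G : digraph) (x : G) : ndist x x = 0.
Proof. by have := @dist_path G x [::] isT; rewrite leqn0 => /eqP. Qed.

Lemma ndist_eq0 (G : digraph) (x y : G) :
  reachable x y -> ndist x y = 0 -> x = y.
Proof.
by move=> /reachable_dist[[|z p] [_ + +]] //=; rewrite -/(ndist x y) => _ <-.
Qed.

Lemma len_cons (G : digraph) (x y : G) s :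
  len (x :: y :: s) = ndist x y + len (y :: s).
Proof. by []. Qed.

Lemma rsorted_cons (G : digraph) (x y : G) s :
  rsorted (x :: y :: s) = reachable x y && rsorted (y :: s).
Proof. by []. Qed.

Lemma rsorted_all (G : digraph) (x : G) s :
  rsorted (x :: s) -> all (reachable x) (x :: s).
Proof.
by move=> /= /(order_path_min (@reachable_trans G)) ->; rewrite reachable_refl.
Qed.

Definition image_of (G H : digraph) (e : G -> H) : pred H :=
  fun x => `[< exists a, e a = x >].

Lemma image_ofP (G H : digraph) (e : G -> H) x :
  reflect (exists a, e a = x) (image_of e x).
Proof. exact: asboolP. Qed.

Lemma image_of_f (G H : digraph) (e : G -> H) a : image_of e (e a).
Proof. by apply/image_ofP; exists a. Qed.

Definition reach_of (G H : digraph) (e : G -> H) : pred H :=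
  fun x => `[< exists a, reachable (e a) x >].

Lemma reach_ofP (G H : digraph) (e : G -> H) x :
  reflect (exists a, reachable (e a) x) (reach_of e x).
Proof. exact: asboolP. Qed.

(* This forces phi to be injective on V0. *)
Definition expanding (G H : digraph) (phi : G -> H) (V0 : pred G) : Prop :=
  {in V0 &, forall x y, reachable (phi x) (phi y) ->
    reachable x y /\ ndist x y <= ndist (phi x) (phi y)}.

Section Expanding.
Variables (G H : digraph) (phi : G -> H) (V0 : pred G).
Hypothesis phi_exp : expanding phi V0.

Lemma expanding_inj : {in V0 &, injective phi}.
Proof.
move=> x y xV yV xy; have := phi_exp xV yV; rewrite xy reachable_refl ndistxx.
by move=> /(_ isT)[xy_reach]; rewrite leqn0 => /eqP/ndist_eq0->.
Qed.

Lemma expanding_word s : all V0 s -> rsorted (map phi s) ->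
  rsorted s /\ len s <= len (map phi s).
Proof.
elim: s => [|x [|y s] IHs] //; rewrite [all _ _]/=.
case/andP=> xV /[dup] ysV /andP[yV _].
rewrite !map_cons !rsorted_cons !len_cons => /andP[/(phi_exp xV yV)[-> xy] ys].
by have [-> ?] := IHs ysV ys; rewrite leq_add.
Qed.

End Expanding.

(* Condition (2) of a cofibration, with the projection as a datum; the converse
   inequality is the triangle inequality. *)
Definition contraction (A X : digraph) (e : A -> X) (k : X -> X) : Prop :=
  forall a x, reachable (e a) x ->
    [/\ image_of e (k x), reachable (e a) (k x), reachable (k x) x &
        ndist (e a) (k x) + ndist (k x) x <= ndist (e a) x].

Section Contraction.
Variables (A X : digraph) (e : A -> X) (k : X -> X).
Hypothesis k_con : contraction e k.

Lemma contraction_id a : k (e a) = e a.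
Proof.
have [_ r1 r2] := k_con (reachable_refl (e a)).
by rewrite ndistxx leqn0 addn_eq0 => /andP[/eqP/(ndist_eq0 r1)].
Qed.

Lemma contraction_image x : reach_of e x -> image_of e (k x).
Proof. by case/reach_ofP => a /k_con[]. Qed.

Lemma contraction_reach x : reach_of e x -> reachable (k x) x.
Proof. by case/reach_ofP => a /k_con[]. Qed.

Lemma contraction_gt0 x : reach_of e x -> ~~ image_of e x -> 0 < ndist (k x) x.
Proof.
move=> xr; apply: contraNltn; rewrite leqn0.
by move/eqP/(ndist_eq0 (contraction_reach xr)) <-; apply: contraction_image.
Qed.

Lemma reach_of_trans x y : reach_of e x -> reachable x y -> reach_of e y.
Proof.
case/reach_ofP => a ax xy; apply/reach_ofP; exists a.
exact: reachable_trans ax xy.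
Qed.

(** As k x lies in the image of e, the contraction property applies to the pair k x, y and bounds
    the sum by d(k x, y); the triangle inequality through x concludes. *)
Lemma contraction_step x y : reach_of e x -> reachable x y ->
  reachable (k x) (k y) /\
  ndist (k x) (k y) + ndist (k y) y <= ndist (k x) x + ndist x y.
Proof.
move=> xr xy; have kxx := contraction_reach xr.
have kxy := reachable_trans kxx xy.
have /image_ofP[b kxE] := contraction_image xr.
move: (kxy); rewrite -{1}kxE => /k_con[_ ? _]; rewrite kxE => h; split=> //.
  by rewrite -kxE.
by apply: leq_trans h _; apply: ndist_triangle.
Qed.

Lemma contraction_word x s : reach_of e x -> rsorted (x :: s) ->
  rsorted (map k (x :: s)) /\
  len (map k (x :: s)) + ndist (k (last x s)) (last x s) <=
    ndist (k x) x + len (x :: s).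
Proof.
elim: s x => [|y s IHs] x xr; first by rewrite /= !addn0 !add0n.
rewrite rsorted_cons => /andP[xy ys].
have [kxy d] := contraction_step xr xy.
have [ks kd] := IHs y (reach_of_trans xr xy) ys.
move: ks kd; rewrite !map_cons rsorted_cons !len_cons kxy [last x _]/=.
by move=> ks kd; split=> //; lia.
Qed.

End Contraction.
End NatDistance.

(** Recording the first entry serves the induction: prepending k x to a list of the prism of y :: s
    adds exactly d(k x, k y). *)
Lemma prism_contraction (R : pzRingType) (A X : digraph) (e : A -> X) k x s :
  contraction e k -> reach_of e x -> rsorted (x :: s) ->
  prism k (flmod_gen (the_free_lmod R (seq X)) (x :: s)) \in
    flmod_span (the_free_lmod R (seq X)) (fun u =>
      [&& starts (pred1 (k x)) u, rsorted u, size u == (size s).+2 &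
          len u <= ndist (k x) x + len (x :: s)]%N).
Proof.
move=> k_con; elim: s x => [|y s IHs] x xr xs.
  rewrite prism_cons_gen prism_nil raddf0 subr0; apply: flmod_span_gen.
  by rewrite /= !eqxx /rsorted /= (contraction_reach k_con xr) leqnn.
rewrite prism_cons_gen submodB //.
  apply: flmod_span_gen; rewrite [starts _ _]/= eqxx rsorted_cons xs.
  by rewrite (contraction_reach k_con xr) eqxx len_cons leqnn.
move: xs; rewrite rsorted_cons => /andP[xy ys].
have [kxy d] := contraction_step k_con xr xy.
apply: flmod_span_linear (IHs y (reach_of_trans xr xy) ys) => -[|z u] //.
rewrite [starts _ _]/= => /and4P[/eqP zE zu /eqP su lu].
rewrite -[X in X \in _]/(wcons (k x) _) wcons_gen; apply: flmod_span_gen.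
rewrite [starts _ _]/= eqxx rsorted_cons zu zE kxy len_cons eqSS -su eqxx.
by move: lu d; rewrite zE len_cons; lia.
Qed.

(** * The operators attached to a pushout *)

(* These properties of the pushout determine all its distances; [gl_dist] deals
   with the paths from Y to the vertices of X outside A. *)
Record gluing (A X Y P : digraph) (i : dihom A X) (f : dihom A Y)
    (g : dihom X P) (j : dihom Y P) (pi : X -> X) (k : P -> P) : Prop := Gluing {
  gl_comm : forall a, g (i a) = j (f a);
  gl_exp_i : expanding i xpredT;
  gl_exp_j : expanding j xpredT;
  gl_exp_g : expanding g (predC (image_of i));
  gl_out : forall x, ~~ image_of i x -> ~~ image_of j (g x);
  gl_cover : forall p, ~~ image_of j p -> exists2 x, ~~ image_of i x & g x = p;
  gl_closed : forall p q, reachable p q -> ~~ image_of j p -> ~~ image_of j q;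
  gl_con_pi : contraction i pi;
  gl_con_k : contraction j k;
  gl_proj : forall x, reach_of i x -> k (g x) = g (pi x);
  gl_dist : forall y x, reachable (j y) (g x) -> ~~ image_of i x ->
    reach_of i x /\
    (ndist (j y) (k (g x)) + ndist (pi x) x <= ndist (j y) (g x))%N }.

Section GluingOps.
Variables (R : pzRingType) (A X Y P : digraph).
Variables (i : dihom A X) (f : dihom A Y) (g : dihom X P) (j : dihom Y P).
Variables (pi : X -> X) (k : P -> P).
Hypothesis gl : gluing i f g j pi k.
Local Notation T G := (the_free_lmod R (seq G)).
Local Notation "[< s >]" := (flmod_gen (T _) s).
Local Notation inA := (image_of i).
Local Notation inY := (image_of j).
Local Notation out := (predC inA).

(** Lifting is restricted to vertices outside A because f, hence g, may identify vertices of A. *)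
Definition wlift : T P -> T X := @winv R X P g out.
HB.instance Definition _ := GRing.Linear.on wlift.

Definition wop_h : T P -> T P := prism k \o @wstart R P inY.
HB.instance Definition _ := GRing.Linear.on wop_h.
Definition wop_r : T P -> T Y :=
  @winv R Y P j xpredT \o (@wmap R P P k \o @wstart R P inY).
HB.instance Definition _ := GRing.Linear.on wop_r.
Definition wop_s : T P -> T A :=
  @winv R A X i xpredT \o (@wmap R X X pi \o (wlift \o @wcross R P inY)).
HB.instance Definition _ := GRing.Linear.on wop_s.
Definition wop_q : T P -> T X :=
  (wlift \o (idfun \- @wstart R P inY)) \+
  (prism pi \o (wlift \o @wcross R P inY)).
HB.instance Definition _ := GRing.Linear.on wop_q.

Lemma wop_qE t :
  wop_q t = wlift (t - wstart inY t) + prism pi (wlift (wcross inY t)).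
Proof. by []. Qed.

Lemma wlift_gen s : all out s -> wlift [< map g s >] = [< s >].
Proof. by move=> ?; apply: winv_gen => //; apply/expanding_inj/(gl_exp_g gl). Qed.

Lemma out_image s : all (predC inY) s -> exists2 xs, s = map g xs & all out xs.
Proof.
elim: s => [|p s IHs] /=; first by exists [::].
case/andP=> /(gl_cover gl)[x xA <-] /IHs[xs -> xsA].
by exists (x :: xs); rewrite //= xA.
Qed.

Lemma rsorted_out s : rsorted s -> ~~ starts inY s -> all (predC inY) s.
Proof.
case: s => // p s /rsorted_all ps pY; apply: sub_all ps => q pq.
exact: (gl_closed gl pq pY).
Qed.

Lemma out_word s : rsorted s -> ~~ starts inY s ->
  exists xs, [/\ s = map g xs, all out xs, rsorted xs & (len xs <= len s)%N].
Proof.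
move=> ss /(rsorted_out ss)/out_image[xs sE xsA]; exists xs; rewrite sE in ss *.
by have [] := expanding_word (gl_exp_g gl) xsA ss.
Qed.

Lemma in_word p s : rsorted (p :: s) -> inY p -> all (reach_of j) (p :: s).
Proof.
move=> /rsorted_all ps /image_ofP[y yE]; apply: sub_all ps => q pq.
by apply/reach_ofP; exists y; rewrite yE.
Qed.

Lemma image_word (V W : digraph) (e : V -> W) s :
  all (image_of e) s -> exists ys, map e ys = s.
Proof.
elim: s => [|w s IHs] /=; first by exists [::].
by move=> /andP[/image_ofP[v <-] /IHs[ys <-]]; exists (v :: ys).
Qed.

Lemma con_word (V W : digraph) (e : V -> W) c s :
  contraction e c -> all (reach_of e) s -> exists ys, map e ys = map c s.
Proof.
move=> c_con sr; apply: image_word; rewrite all_map; apply: sub_all sr => w.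
exact: contraction_image.
Qed.

(** By [gl_dist] the step from p to g x is at least d(pi x, x) long. Deleting p frees this amount,
    which the prism and the projection then spend. *)
Lemma cross_word p s : inY p -> rsorted (p :: s) -> ~~ starts inY s ->
  exists xs, [/\ s = map g xs, all out xs, all (reach_of i) xs, rsorted xs &
    forall x xs', xs = x :: xs' ->
      (ndist (pi x) x + len xs <= len (p :: s))%N].
Proof.
move=> /image_ofP[y <-] ps sY.
have [xs [sE xsA xss xsl]] : exists xs,
    [/\ s = map g xs, all out xs, rsorted xs & (len xs <= len s)%N].
  by apply: out_word => //; move: ps => /path_sorted.
exists xs; case: xs sE xsA xss xsl => [|x xs] sE xsA xss xsl; first by split.
move: ps; rewrite sE map_cons rsorted_cons => /andP[yx _].
have /andP[xA _] := xsA; have [xr xd] := gl_dist gl yx xA.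
split=> //; last first.
  move=> _ _ [] <- _; rewrite len_cons -map_cons -sE.
  by apply: leq_add xsl; apply: leq_trans xd; apply: leq_addl.
by apply: sub_all (rsorted_all xss) => x'; apply: reach_of_trans.
Qed.

Lemma wop_q_out xs : all out xs -> wop_q [< map g xs >] = [< xs >].
Proof.
move=> xsA; rewrite wop_qE wstart_gen.
have -> : starts inY (map g xs) = false.
  by case: xs xsA => //= x xs /andP[/(gl_out gl)/negPf].
have -> : wcross inY [< map g xs >] = 0.
  case: xs xsA => [|x xs] /=; first by rewrite wcross_nil.
  by move=> /andP[/(gl_out gl)/negPf xY _]; rewrite wcross_gen xY.
by rewrite !raddf0 !addr0 wlift_gen.
Qed.

Lemma wop_q_in p s : inY p -> wop_q [< p :: s >] =
  if ~~ starts inY s then prism pi (wlift [< s >]) else 0.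
Proof.
move=> pY; rewrite wop_qE wstart_gen /= pY subrr raddf0 add0r wcross_gen pY /=.
by case: ifP => _; rewrite ?raddf0.
Qed.

Lemma wop_s_in p s : inY p -> wop_s [< p :: s >] =
  if ~~ starts inY s then winv i xpredT (wmap pi (wlift [< s >])) else 0.
Proof.
by move=> pY; rewrite /= /wop_s /= wcross_gen pY /=; case: ifP; rewrite ?raddf0.
Qed.

Lemma wop_s_out s : ~~ starts inY s -> wop_s [< s >] = 0.
Proof.
rewrite /= /wop_s /=; case: s => [|p s] /= pY; first by rewrite wcross_nil !raddf0.
by rewrite wcross_gen (negPf pY) !raddf0.
Qed.

Lemma word_filP (G : digraph) (p n : int) (s : seq G) :
  rsorted s -> (size s)%:Z = n + 1 -> (len s)%:Z <= p -> word_fil p n s.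
Proof. by move=> ss sn sp; rewrite /word_fil ss sn eqxx sp orbT. Qed.

(** The lists kept by [wstart] begin in Y, which k fixes, so the extra distance from k p to p in the
    length bound is 0. *)
Lemma wop_h_op : word_op wop_h 0 1.
Proof.
split; last 1 first.
- by left; rewrite /= /wop_h /= wstart_gen raddf0.
- move=> s ss; rewrite /= /wop_h /= wstart_gen.
  case: s ss => [|p s] ss; first by rewrite raddf0 rpred0.
  rewrite [starts _ _]/=; case: ifP => pY; last by rewrite raddf0 rpred0.
  have pr : reach_of j p by have /andP[] := in_word ss pY.
  apply: lmod_span_sub (prism_contraction R (gl_con_k gl) pr ss) => u.
  case/and4P=> _ us /eqP su lu; apply: word_filP => //.
    by rewrite su /=; lia.
  move: lu; have /image_ofP[y <-] := pY.
  by rewrite (contraction_id (gl_con_k gl)) ndistxx; lia.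
by move=> t tr; apply/prism_rep/wstart_rep.
Qed.

Lemma wop_r_op : word_op wop_r 0 0.
Proof.
split; last 1 first.
- by left; rewrite /= /wop_r /= wstart_gen !raddf0.
- move=> s ss; rewrite /= /wop_r /= wstart_gen.
  case: s ss => [|p s] ss; first by rewrite !raddf0 rpred0.
  rewrite [starts _ _]/=; case: ifP => pY; last by rewrite !raddf0 rpred0.
  have pr : reach_of j p by have /andP[] := in_word ss pY.
  have [ys ysE] := con_word (gl_con_k gl) (in_word ss pY).
  rewrite wmap_gen -ysE winv_gen ?all_predT //; last first.
    by apply/expanding_inj/(gl_exp_j gl).
  have [ks kl] := contraction_word (gl_con_k gl) pr ss.
  have [|yss ysl] := expanding_word (gl_exp_j gl) (all_predT ys).
    by rewrite ysE.
  apply/flmod_span_gen/word_filP => //.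
    by rewrite -(size_map j) ysE size_map; lia.
  move: kl ysl; rewrite -ysE; have /image_ofP[y <-] := pY.
  by rewrite (contraction_id (gl_con_k gl)) ndistxx; lia.
move=> t tr; apply: winv_rep; last exact/wmap_rep/wstart_rep.
exact/expanding_inj/(gl_exp_j gl).
Qed.

Lemma wop_q_op : word_op wop_q 0 0.
Proof.
split; last 1 first.
- by right; apply: (wop_q_out (xs := [::])).
- move=> s ss; have [sY|sY] := boolP (starts inY s); last first.
    have [xs [sE xsA xss xsl]] := out_word ss sY.
    rewrite /= sE wop_q_out // -sE; apply/flmod_span_gen/word_filP => //.
      by rewrite sE size_map; lia.
    by rewrite addr0 lez_nat.
  case: s sY ss => // p s pY ss; rewrite [X in X \in _]wop_q_in //.
  case: ifP => [sY|_]; last exact: rpred0.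
  have [xs [sE xsA xsr xss xsl]] := cross_word pY ss sY.
  rewrite {1}sE wlift_gen //.
  case: xs sE xsA xsr xss xsl => [|x xs] sE xsA xsr xss xsl.
    by rewrite prism_nil rpred0.
  have /andP[xr _] := xsr; have xl := xsl x xs erefl.
  apply: lmod_span_sub (prism_contraction R (gl_con_pi gl) xr xss) => u.
  case/and4P=> _ us /eqP su lu; apply: word_filP => //.
    by rewrite su sE /= size_map; lia.
  by move: lu xl; lia.
move=> t tr; have inj_g := expanding_inj (gl_exp_g gl).
rewrite /= wop_qE rpredD //.
  by apply/winv_rep/submodB/wstart_rep.
by apply/prism_rep/winv_rep/wcross_rep.
Qed.

Lemma wop_s_op : word_op wop_s (-1) (-1).
Proof.
split; last 1 first.
- by left; apply: wop_s_out.
- move=> s ss; have [sY|sY] := boolP (starts inY s); last first.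
    by rewrite [X in X \in _]wop_s_out // rpred0.
  case: s sY ss => // p s pY ss; rewrite [X in X \in _]wop_s_in //.
  case: ifP => [sY|_]; last exact: rpred0.
  have [xs [sE xsA xsr xss xsl]] := cross_word pY ss sY.
  have [ys ysE] := con_word (gl_con_pi gl) xsr.
  rewrite {1}sE wlift_gen // wmap_gen -ysE winv_gen ?all_predT //; last first.
    by apply/expanding_inj/(gl_exp_i gl).
  case: xs sE xsA xsr xss xsl ysE => [|x xs] sE xsA xsr xss xsl ysE.
    (* A list made of one vertex of Y crosses to the empty list, which [word_fil] admits in every
       degree and filtration. *)
    by case: ys ysE => // _; apply: flmod_span_gen.
  have xr := allP xsr _ (mem_last x xs); have xA := allP xsA _ (mem_last x xs).
  (* This positive distance at the last vertex, which lies outside A, is the source of the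
     filtration shift by -1. *)
  have x0 : (0 < ndist (pi (last x xs)) (last x xs))%N.
    exact: (contraction_gt0 (gl_con_pi gl) xr xA).
  have {}xr : reach_of i x by have /andP[] := xsr.
  have [ks kl] := contraction_word (gl_con_pi gl) xr xss.
  have [|yss ysl] := expanding_word (gl_exp_i gl) (all_predT ys).
    by rewrite ysE.
  apply/flmod_span_gen/word_filP => //.
    by rewrite -(size_map i) ysE sE !size_map /= !size_map; lia.
  by move: (xsl x xs erefl) kl ysl x0; rewrite -ysE; lia.
move=> t tr; have inj_g := expanding_inj (gl_exp_g gl).
apply: winv_rep; first exact/expanding_inj/(gl_exp_i gl).
by apply/wmap_rep/winv_rep/wcross_rep.
Qed.

Definition crossed : pred P := predI (reach_of j) (predC inY).

Lemma crossed_image s : all crossed s ->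
  exists xs, [/\ s = map g xs, all out xs & all (reach_of i) xs].
Proof.
rewrite all_predI => /andP[sr /out_image[xs sE xsA]]; exists xs; split=> //.
move: sr xsA; rewrite sE; elim: xs {sE} => //= x xs IHs.
case/andP=> /reach_ofP[y yx] sr /andP[xA /(IHs sr)->].
by have [-> _] := gl_dist gl yx xA.
Qed.

Lemma wmap_wlift t :
  t \in flmod_span (T P) (all (predC inY)) -> wmap g (wlift t) = t.
Proof.
apply: (@flmod_span_eq _ _ _ _ (@wmap R X P g \o wlift) idfun) => s /=.
by move=> /out_image[xs -> xsA]; rewrite wlift_gen // wmap_gen.
Qed.

Lemma wlift_bd t :
  t \in flmod_span (T P) (all (predC inY)) -> wbd (wlift t) = wlift (wbd t).
Proof.
move=> tY; have lA : wlift t \in flmod_span (T X) (all out).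
  apply: flmod_span_linear tY => s /out_image[xs -> xsA] /=.
  by rewrite wlift_gen // flmod_span_gen.
have gI := expanding_inj (gl_exp_g gl).
by rewrite -{2}(wmap_wlift tY) [RHS](winv_bd gI lA) (winv_map gI lA).
Qed.

Lemma wlift_reach t : t \in flmod_span (T P) (all crossed) ->
  wlift t \in flmod_span (T X) (all (reach_of i)).
Proof.
apply: flmod_span_linear => s /crossed_image[xs [-> xsA xsr]] /=.
by rewrite wlift_gen // flmod_span_gen.
Qed.

(** On the reach of A the map g intertwines pi and k, hence also their prisms. *)
Lemma wmap_prism t : t \in flmod_span (T P) (all crossed) ->
  wmap g (prism pi (wlift t)) = prism k t.
Proof.
apply: (@flmod_span_eq _ _ _ _
  (@wmap R X P g \o (@prism R X pi \o wlift)) (@prism R P k)) => s /=.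
move=> /crossed_image[xs [-> xsA xsr]]; rewrite wlift_gen //.
elim: xs xsr {xsA} => [|x xs IHs] /=; first by rewrite !prism_nil raddf0.
case/andP=> xr /IHs{}IHs; rewrite !prism_cons_gen linearB /= wmap_cons IHs.
by rewrite wmap_gen /= (gl_proj gl).
Qed.

Section ContractionWords.
Variables (V W : digraph) (e : V -> W) (c : W -> W).
Hypotheses (e_exp : expanding e xpredT) (c_con : contraction e c).

Lemma wmap_winv_con (t : T W) : t \in flmod_span (T W) (all (reach_of e)) ->
  wmap e (winv e xpredT (wmap c t)) = wmap c t.
Proof.
apply: (@flmod_span_eq _ _ _ _ (@wmap R V W e \o
  (@winv R V W e xpredT \o @wmap R W W c)) (@wmap R W W c)) => s /= sr.
rewrite wmap_gen; have [ys <-] := con_word c_con sr.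
by rewrite winv_gen ?all_predT ?wmap_gen //; apply: expanding_inj.
Qed.

Lemma winv_con_bd (t : T W) : t \in flmod_span (T W) (all (reach_of e)) ->
  wbd (winv e xpredT (wmap c t)) = winv e xpredT (wmap c (wbd t)).
Proof.
move=> tr; rewrite wmap_bd -[in RHS](wmap_winv_con tr).
have eI := expanding_inj e_exp; set u := winv e _ _.
have uT : u \in flmod_span (T V) (all xpredT).
  by apply: lmod_span_sub (flmod_span_all u) => s _; apply: all_predT.
by rewrite (winv_bd eI uT) (winv_map eI uT).
Qed.

End ContractionWords.

Lemma proj_word s ys : all (reach_of i) s -> map i ys = map pi s ->
  map k (map g s) = map j (map f ys).
Proof.
move=> sr ysE; have -> : map j (map f ys) = map g (map pi s).
  by rewrite -ysE -!map_comp; apply: eq_map => a /=; rewrite (gl_comm gl).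
by rewrite -!map_comp; apply/eq_in_map => x /(allP sr) /(gl_proj gl).
Qed.

Lemma winv_crossed t : t \in flmod_span (T P) (all crossed) ->
  winv j xpredT (wmap k t) =
  wmap f (winv i xpredT (wmap pi (wlift t))).
Proof.
apply: (@flmod_span_eq _ _ _ _ (@winv R Y P j xpredT \o @wmap R P P k)
  (@wmap R A Y f \o (@winv R A X i xpredT \o (@wmap R X X pi \o wlift)))) => s /=.
move=> /crossed_image[xs [-> xsA xsr]]; rewrite wlift_gen // !wmap_gen.
have [ys ysE] := con_word (gl_con_pi gl) xsr.
rewrite (proj_word xsr ysE).
rewrite -ysE !winv_gen ?all_predT ?wmap_gen //.
  exact/expanding_inj/(gl_exp_i gl).
exact/expanding_inj/(gl_exp_j gl).
Qed.

(** * The chain map and homotopy identities on lists *)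

Section Identities.
Variable t : T P.
Hypothesis tS : t \in flmod_span (T P) (@rsorted P).

Lemma start_reach : wstart inY t \in flmod_span (T P) (all (reach_of j)).
Proof. by apply: wstart_span tS => -[|p s] // ss; apply: in_word. Qed.

Lemma cross_crossed : wcross inY t \in flmod_span (T P) (all crossed).
Proof.
apply: lmod_span_sub (wcross_span (@rsorted_face P) rsorted_out _ tS).
  by move=> s /andP[_]; apply.
by move=> [|p s] // ss; apply: in_word.
Qed.

Lemma cross_out : wcross inY t \in flmod_span (T P) (all (predC inY)).
Proof.
by apply: lmod_span_sub cross_crossed; apply: sub_all => p /andP[].
Qed.

Lemma out_out : t - wstart inY t \in flmod_span (T P) (all (predC inY)).
Proof. by apply: lmod_span_sub (wstart_out_span rsorted_out tS) => s /andP[]. Qed.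

Let start_bd := wstart_bd rsorted_out tS.
Let cross_bd := wcross_bd (@rsorted_face P) rsorted_out tS.

(** This is the prism identity for [wstart t], whose projection by k is the image of [wop_r t]. The
    correction term of [wstart_bd] produces the prism of [wcross t], the second summand of
    [wop_q]. *)
Lemma wop_h_bd : wbd (wop_h t) + wop_h (wbd t) =
  t - wmap g (wop_q t) - wmap j (wop_r t).
Proof.
rewrite /wop_h /wop_r wop_qE linearD /=.
rewrite (wmap_wlift out_out) (wmap_prism cross_crossed).
rewrite (wmap_winv_con (gl_exp_j gl) (gl_con_k gl) start_reach).
rewrite start_bd linearB /= addrA prism_bd; zmod.
Qed.

(** The first summand of [wop_q] fails to commute with the boundary by the lift of [wcross t]. The
    prism identity for this lift replaces the defect by its projection to A. *)
Lemma wop_q_bd : wbd (wop_q t) - wop_q (wbd t) = - wmap i (wop_s t).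
Proof.
have sE : wmap i (wop_s t) = wmap pi (wlift (wcross inY t)).
  exact: (wmap_winv_con (gl_exp_i gl) (gl_con_pi gl) (wlift_reach cross_crossed)).
have := prism_bd pi (wlift (wcross inY t)); rewrite -sE (wlift_bd cross_out).
rewrite !wop_qE cross_bd start_bd [wbd (_ + _)]linearD /= (wlift_bd out_out).
rewrite [wlift (- _)]linearN [prism _ (- _)]linearN /= [wbd (t - _)]linearB /=.
have -> a b c : wlift (a - (b - c)) = wlift (a - b) + wlift c.
  by rewrite -linearD /= opprB addrA addrAC.
move=> /(canRL (addrK _)) ->; zmod.
Qed.

Lemma wop_r_bd : wbd (wop_r t) - wop_r (wbd t) = wmap f (wop_s t).
Proof.
rewrite -[wmap f _](winv_crossed cross_crossed) /wop_r /=.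
rewrite (winv_con_bd (gl_exp_j gl) (gl_con_k gl) start_reach) start_bd.
by rewrite [wmap _ (_ - _)]linearB [winv _ _ (_ - _)]linearB /= opprB addrC subrK.
Qed.

Lemma wop_s_bd : wbd (wop_s t) + wop_s (wbd t) = 0.
Proof.
rewrite /= /wop_s /= cross_bd [wlift (- _)]linearN [wmap _ (- _)]linearN /=.
rewrite [winv _ _ (- _)]linearN /= -(wlift_bd cross_out).
rewrite -(winv_con_bd (gl_exp_i gl) (gl_con_pi gl) (wlift_reach cross_crossed)).
exact: subrr.
Qed.

End Identities.

End GluingOps.

Definition dihom_id (G : digraph) : dihom G G :=
  @Dihom G G idfun (fun x y xy => or_intror xy).

Section GluingChains.
Variables (R : pzRingType) (A X Y P : digraph).
Variables (i : dihom A X) (f : dihom A Y) (g : dihom X P) (j : dihom Y P).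
Variables (pi : X -> X) (k : P -> P).
Hypothesis gl : gluing i f g j pi k.
Local Notation T G := (the_free_lmod R (seq G)).
Local Notation "[< s >]" := (flmod_gen (T _) s).
Local Notation id_X := (dihom_id X).
Local Notation id_A := (dihom_id A).

Lemma gl_image x : image_of j (g x) = image_of i x.
Proof.
apply/idP/idP; first by apply: contraLR => /(gl_out gl).
by case/image_ofP=> a <-; rewrite (gl_comm gl) image_of_f.
Qed.

(** X is a gluing of itself along the identity of A; the operators of this gluing retract X to A and
    give the homotopy on X. That no path returns to A is pulled back from P along g. *)
Lemma gluing_self : gluing i id_A id_X i pi pi.
Proof.
split=> //=.
- exact: gl_exp_i gl.
- exact: gl_exp_i gl.
- by move=> x xA; exists x.
- move=> x y xy; rewrite -!gl_image; apply: (gl_closed gl).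
  exact: dihom_reachable.
- exact: gl_con_pi gl.
- exact: gl_con_pi gl.
move=> a x ax _; split; first by apply/reach_ofP; exists a.
by have [] := gl_con_pi gl ax.
Qed.

Lemma starts_map s : starts (image_of j) (map g s) = starts (image_of i) s.
Proof. by case: s => //= x s; rewrite gl_image. Qed.

Let gl' := gluing_self.

Lemma wlift_out s : rsorted s -> ~~ starts (image_of i) s ->
  wlift i g [< map g s >] = [< s >] /\ wlift i id_X [< s >] = [< s >].
Proof.
move=> ss /(rsorted_out gl' ss) sA; split; first exact: (wlift_gen R gl sA).
by rewrite -{1}[s]map_id; exact: (wlift_gen R gl' sA).
Qed.

(** By [gl_image], a list of X crosses out of A exactly where its image crosses out of Y, and the
    two lifts of the remaining tail agree. *)
Lemma wop_q_map t : t \in flmod_span (T X) (@rsorted X) ->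
  wop_q i g j pi (wmap g t) = wop_q i id_X i pi t.
Proof.
apply: (@flmod_span_eq _ _ _ _ (wop_q i g j pi \o @wmap R X P g)
  (wop_q i id_X i pi)) => s ss /=; rewrite wmap_gen.
have [sA|sA] := boolP (starts (image_of i) s); last first.
  have sO := rsorted_out gl' ss sA; rewrite (wop_q_out _ gl) //.
  by rewrite -[in RHS](map_id s) (wop_q_out _ gl').
case: s sA ss => // x s xA ss; rewrite map_cons.
rewrite (wop_q_in _ i g pi) ?gl_image // (wop_q_in _ i id_X pi) //.
rewrite starts_map; case: ifP => // sA.
by have [-> ->] := wlift_out (path_sorted ss) sA.
Qed.

Lemma wop_s_map t : t \in flmod_span (T X) (@rsorted X) ->
  wop_s i g j pi (wmap g t) = wop_s i id_X i pi t.
Proof.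
apply: (@flmod_span_eq _ _ _ _ (wop_s i g j pi \o @wmap R X P g)
  (wop_s i id_X i pi)) => s ss /=; rewrite wmap_gen.
have [sA|sA] := boolP (starts (image_of i) s); last first.
  by rewrite !wop_s_out ?starts_map.
case: s sA ss => // x s xA ss; rewrite map_cons.
rewrite (wop_s_in _ i g pi) ?gl_image // (wop_s_in _ i id_X pi) //.
rewrite starts_map; case: ifP => // sA.
by have [-> ->] := wlift_out (path_sorted ss) sA.
Qed.

Lemma wop_r_map t : t \in flmod_span (T X) (@rsorted X) ->
  wop_r j k (wmap g t) = wmap f (wop_r i pi t).
Proof.
apply: (@flmod_span_eq _ _ _ _ (wop_r j k \o @wmap R X P g)
  (@wmap R A Y f \o wop_r i pi)) => s ss.
rewrite /= /wop_r /= wmap_gen !wstart_gen starts_map.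
case: ifP => sA; last by rewrite !raddf0.
have sr : all (reach_of i) s by case: s sA ss => // x s xA ss; apply: in_word.
have [ys ysE] := con_word (gl_con_pi gl) sr.
rewrite !wmap_gen -ysE (winv_gen _ (expanding_inj (gl_exp_i gl))) ?all_predT //.
rewrite (proj_word gl sr ysE) wmap_gen.
by rewrite (winv_gen _ (expanding_inj (gl_exp_j gl))) ?all_predT.
Qed.

(** [word_chain] is needed because [wop_r] sends the empty list to 0. *)
Lemma wop_r_in t : word_chain R Y (wop_r j k (wmap j t)) = word_chain R Y t.
Proof.
apply: (@lmod_eq _ _ _
  (word_chain R Y \o (wop_r j k \o @wmap R Y P j)) (word_chain R Y)) => s.
rewrite /= /wop_r /= wmap_gen wstart_gen; case: s => [|y s] /=.
  by rewrite !raddf0 word_chain_nil.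
rewrite image_of_f wmap_gen.
have -> : map k (j y :: map j s) = map j (y :: s).
  rewrite -map_cons -map_comp; apply: eq_map => z /=.
  exact: contraction_id (gl_con_k gl) z.
by rewrite (winv_gen _ (expanding_inj (gl_exp_j gl))) ?all_predT.
Qed.

Lemma wlift_nil : wlift i g [< [::] >] = [< [::] >].
Proof. exact: (wlift_gen R gl (s := [::])). Qed.

Lemma wop_q_j t : word_chain R X (wop_q i g j pi (wmap j t)) = 0.
Proof.
apply: (@lmod_eq _ _ _
  (word_chain R X \o (wop_q i g j pi \o @wmap R Y P j)) \0) => s /=.
rewrite wmap_gen; case: s => [|y [|z s]].
- by rewrite (wop_q_out R gl (xs := [::])) // word_chain_nil.
- by rewrite wop_q_in ?image_of_f //= wlift_nil prism_nil raddf0.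
by rewrite wop_q_in ?image_of_f //= image_of_f raddf0.
Qed.

Lemma wop_s_j t : word_chain R A (wop_s i g j pi (wmap j t)) = 0.
Proof.
apply: (@lmod_eq _ _ _
  (word_chain R A \o (wop_s i g j pi \o @wmap R Y P j)) \0) => s /=.
rewrite wmap_gen; case: s => [|y [|z s]].
- by rewrite wop_s_out // raddf0.
- rewrite wop_s_in ?image_of_f //= wlift_nil wmap_gen.
  rewrite (winv_gen R (expanding_inj (gl_exp_i gl)) (s := [::])) //.
  exact: word_chain_nil.
by rewrite wop_s_in ?image_of_f //= image_of_f raddf0.
Qed.

End GluingChains.

(** * Distances in a pushout *)

Section PushoutDistances.
Local Open Scope nat_scope.

Lemma dist_reachable (G : digraph) (x y : G) :
  reachable x y -> dist x y = Some (ndist x y).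
Proof. by rewrite /reachable /ndist; case: dist. Qed.

Lemma edge_reachable (G : digraph) (x y : G) : edge x y -> reachable x y.
Proof. by move=> xy; apply/reachableP; exists [:: y]; rewrite //= xy. Qed.

Lemma edge_ndist (G : digraph) (x y : G) : edge x y -> ndist x y <= 1.
Proof. by move=> xy; apply: (@dist_path _ x [:: y]); rewrite /= xy. Qed.

(* The maps of digraphs to this digraph are the functions with values in the
   extended natural numbers that grow by at most 1 along each edge; hence they
   bound distances from below. *)
Definition growth_edge : rel (option nat) := fun m n =>
  match m, n with
  | None, _ => true
  | Some _, None => false
  | Some a, Some b => b <= a.+1
  end.
Definition growth : digraph := @Digraph (option nat) growth_edge.

Lemma growth_bound (G : digraph) (u : dihom G growth) x y a :
  u x = Some a -> reachable x y -> exists2 b, u y = Some b & b <= a + ndist x y.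
Proof.
move=> + /reachable_dist[p [xp <-]]; rewrite -/(ndist x _) => + <-.
elim: p x a xp => [|z p IHp] x a /=; first by move=> _ ->; exists a; rewrite ?addn0.
case/andP=> xz zp ux; have [b uz ba] : exists2 b, u z = Some b & b <= a.+1.
  case: (dihomP u xz); first by rewrite ux => <-; exists a.
  by rewrite ux /=; case: (u z) => // b ba; exists b.
by have [c uc cb] := IHp z b zp uz; exists c => //; lia.
Qed.

Lemma dist_growth (G : digraph) (x y z : G) :
  edge y z -> growth_edge (dist x y) (dist x z).
Proof.
move=> yz; case xy: (dist x y) => [n|] //.
have xyR : reachable x y by rewrite /reachable xy.
have xzR := reachable_trans xyR (edge_reachable yz).
rewrite (dist_reachable xzR) /=.
have nE : ndist x y = n by rewrite /ndist xy.
by have := ndist_triangle xyR (edge_reachable yz); have := edge_ndist yz; lia.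
Qed.

Section Cofibration.
Variables (A X : digraph) (i : dihom A X).
Hypothesis i_cof : cofibration i.

Lemma cofibration_image x a : reachable x (i a) -> image_of i x.
Proof.
case: i_cof => _ _ i_out _ /reachableP[p xp].
elim: p x xp => [|y p IHp] x /=; first by move=> _ ->; apply: image_of_f.
case/andP=> xy yp /(IHp y yp)/image_ofP[b yE]; apply/negPn/negP => xA.
suff: ~~ edge x (i b) by rewrite yE xy.
by apply: i_out => c cx; case/image_ofP: xA; exists c.
Qed.

(** No edge enters A from outside, so a path of X ending in A and starting in A stays in A. Since A
    is an induced subgraph, it lifts to a path of the same length. *)
Lemma cofibration_expanding : expanding i xpredT.
Proof.
case: (i_cof) => i_inj i_edge _ _ a b _ _ /reachable_dist[p [ap pb pn]].
have [q [aq qb qp]] :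
    exists q, [/\ path (@edge A) a q, last a q = b & size q = size p].
  elim: p a ap pb {pn} => [|x p IHp] a /=; first by move=> _ /i_inj ->; exists [::].
  case/andP=> ax xp pb; have /image_ofP[c cx] : image_of i x.
    by apply: (@cofibration_image _ b); apply/reachableP; exists p.
  rewrite -cx in ax xp pb; have [q [cq qb qp]] := IHp c xp pb.
  by exists (c :: q); rewrite /= -i_edge ax qp.
split; first by apply/reachableP; exists q.
by rewrite /ndist -pn -qp -qb dist_path.
Qed.

Lemma cofibration_projection : exists pi : X -> X, contraction i pi.
Proof.
case: i_cof => _ _ _ i_proj.
(* Off the reach of A the default value is x itself, since A may be empty. *)
exists (fun x => if pselect (exists a, reachable (i a) x) is left h
                 then i (sval (cid (i_proj x h))) else x) => a x ax.
case: pselect => [h|[]]; last by exists a.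
case: cid => b /= /(_ a) E; have := dist_reachable ax; rewrite E.
case ab: (dist (i a) (i b)) => [m|] //; case bx: (dist (i b) x) => [n|] //= _.
split; first exact: image_of_f.
- by rewrite /reachable ab.
- by rewrite /reachable bx.
by rewrite /ndist E ab bx.
Qed.

End Cofibration.

(** * Distance functions obtained from the universal property *)

Section Pushout.
Variables (A X Y P : digraph).
Variables (i : dihom A X) (f : dihom A Y) (g : dihom X P) (j : dihom Y P).
Hypotheses (i_cof : cofibration i) (P_po : is_pushout i f g j).
Variable pi : X -> X.
Hypothesis pi_con : contraction i pi.
Local Notation inA := (image_of i).
Local Notation inY := (image_of j).

Let comm a : g (i a) = j (f a). Proof. exact: P_po.1. Qed.
Let i_inj : injective i. Proof. by case: i_cof. Qed.

(** Every function to the complete digraph on two vertices is a map. The constant [true] and the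
    indicator of the union of the two images agree on X and Y, hence on P by uniqueness. *)
Lemma pushout_cover p : ~~ inY p -> exists2 x, ~~ inA x & g x = p.
Proof.
pose B := @Digraph bool (fun _ _ => true).
have toB (G : digraph) (c : G -> B) : {w : dihom G B | w =1 c}.
  by exists (@Dihom G B c (fun _ _ _ => or_intror isT)).
have [u uE] := toB X xpredT; have [v vE] := toB Y xpredT.
have [w [_ _ wU]] := P_po.2 B u v (fun a => etrans (uE _) (esym (vE _))).
have [w1 w1E] := toB P xpredT.
have [w2 w2E] := toB P (fun p => image_of g p || inY p).
have : image_of g p || inY p.
  rewrite -w2E wU -?(wU w1) ?w1E // => x.
  - by rewrite w1E uE.
  - by rewrite w1E vE.
  - by rewrite w2E uE image_of_f.
  by rewrite w2E vE image_of_f orbT.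
case/orP=> [/image_ofP[x <-] xY|->] //; exists x => //.
by apply: contra xY => /image_ofP[a <-]; rewrite comm image_of_f.
Qed.

(* The distances in P from [j y] to the vertices [g x]. *)
Let uX y x : option nat :=
  if pselect (exists b, i b = pi x) is left h
  then add_dist (dist y (f (sval (cid h)))) (dist (pi x) x) else None.

Let uXE y x b : i b = pi x -> uX y x = add_dist (dist y (f b)) (dist (pi x) x).
Proof.
rewrite /uX => bE; case: pselect => [h|[]]; last by exists b.
by case: cid => c /=; rewrite -bE => /i_inj ->.
Qed.

Let uX_some y x n : uX y x = Some n -> exists b,
  [/\ i b = pi x, reachable y (f b), reachable (pi x) x &
      n = ndist y (f b) + ndist (pi x) x].
Proof.
move=> uxn; have [b bE] : exists b, i b = pi x.
  by move: uxn; rewrite /uX; case: pselect.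
exists b; move: uxn; rewrite (uXE y bE) /reachable /ndist.
by case: (dist y (f b)) => // m1; case: (dist _ x) => // m2 [<-].
Qed.

(** Going from x to x' replaces d(pi x, x) by d(pi x, pi x') + d(pi x', x'), which is larger by at
    most 1 by [contraction_step]; f does not increase the distance between the projections. *)
Let uX_edge y x x' : edge x x' -> growth_edge (uX y x) (uX y x').
Proof.
move=> xx'; case ux: (uX y x) => [n|] //.
have [b [bE yb xR ->]] := uX_some ux.
have xr : reach_of i x by apply/reach_ofP; exists b; rewrite bE.
have xx'R := edge_reachable xx'; have x'r := reach_of_trans xr xx'R.
have [pR pd] := contraction_step pi_con xr xx'R.
have /image_ofP[b' b'E] := contraction_image pi_con x'r.
have [bb' d1] : reachable b b' /\ ndist b b' <= ndist (pi x) (pi x').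
  by rewrite -bE -b'E; apply: cofibration_expanding; rewrite // bE b'E.
have yb' := reachable_trans yb (dihom_reachable f bb').
rewrite (uXE y b'E) !dist_reachable ?(contraction_reach pi_con) //=.
have := ndist_triangle yb (dihom_reachable f bb').
have : ndist (f b) (f b') <= ndist b b' by apply: dihom_dist.
by have := edge_ndist xx'; lia.
Qed.

Let uX_image y a : uX y (i a) = dist y (f a).
Proof.
have aE := contraction_id pi_con a; rewrite (uXE y (esym aE)) aE.
rewrite (dist_reachable (reachable_refl _)) ndistxx.
by case: (dist y (f a)) => [n|] //; rewrite /add_dist addn0.
Qed.

Lemma pushout_from_in y : exists w : dihom P growth,
  [/\ forall y', w (j y') = dist y y' &
      forall x n, w (g x) = Some n -> exists b,
        [/\ i b = pi x, reachable y (f b), reachable (pi x) x &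
            n = ndist y (f b) + ndist (pi x) x]].
Proof.
pose u := @Dihom X growth (uX y) (fun _ _ xx' => or_intror (uX_edge y xx')).
pose v := @Dihom Y growth (dist y) (fun _ _ yy' => or_intror (dist_growth y yy')).
have [w [wX wY _]] := P_po.2 growth u v (uX_image y).
by exists w; split=> // x n; rewrite wX; apply: uX_some.
Qed.

(** The distance from x is set to infinity on A and glued with the constant infinity on Y. No edge
    from outside A enters A, so no finite value steps to infinity. *)
Lemma pushout_from_out x : ~~ inA x -> exists w : dihom P growth,
  [/\ forall y, w (j y) = None &
      forall x', w (g x') = if inA x' then None else dist x x'].
Proof.
case: i_cof => _ _ i_out _ xA.
have u_edge x1 x2 : edge x1 x2 -> growth_edge
    (if inA x1 then None else dist x x1) (if inA x2 then None else dist x x2).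
  move=> x12; case: ifPn => // x1A; case: ifPn => [/image_ofP[a aE]|_].
    suff: ~~ edge x1 (i a) by rewrite aE x12.
    by apply: i_out => b bE; case/image_ofP: x1A; exists b.
  exact: dist_growth.
pose u := @Dihom X growth _ (fun _ _ x12 => or_intror (u_edge _ _ x12)).
pose v := @Dihom Y growth (fun=> None) (fun _ _ _ => or_introl erefl).
have [w [wX wY _]] : exists w : dihom P growth,
    [/\ forall x, w (g x) = u x, forall y, w (j y) = v y & True].
  have [a|w [wX wY _]] := P_po.2 growth u v _; last by exists w.
  by rewrite /= image_of_f.
by exists w.
Qed.

Lemma pushout_gluing : exists k : P -> P, gluing i f g j pi k.
Proof.
have g_out x : ~~ inA x -> ~~ inY (g x).
  move=> xA; apply/image_ofP => -[y yE].
  have [w [wY wX]] := pushout_from_out xA.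
  have := wX x; rewrite -yE wY (negPf xA).
  by rewrite (dist_reachable (reachable_refl x)).
have g_exp : expanding g (predC inA).
  move=> x x' xA x'A xx'; have [w [_ wX]] := pushout_from_out xA.
  have wx : w (g x) = Some 0.
    by rewrite wX (negPf xA) (dist_reachable (reachable_refl x)) ndistxx.
  have [b] := growth_bound wx xx'; rewrite wX (negPf x'A) add0n => xb bd.
  by rewrite /reachable {1}/ndist xb.
have j_exp : expanding j xpredT.
  move=> y y' _ _ yy'; have [w [wY _]] := pushout_from_in y.
  have wy : w (j y) = Some 0.
    by rewrite wY (dist_reachable (reachable_refl y)) ndistxx.
  have [b] := growth_bound wy yy'; rewrite wY add0n => yb bd.
  by rewrite /reachable {1}/ndist yb.
(* The growth bound turns the formula of [pushout_from_in] into a lower bound for the distance in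
   P. *)
have g_dist y x : reachable (j y) (g x) -> exists b,
    [/\ i b = pi x, reachable y (f b), reachable (pi x) x &
        ndist y (f b) + ndist (pi x) x <= ndist (j y) (g x)].
  move=> yx; have [w [wY wX]] := pushout_from_in y.
  have wy : w (j y) = Some 0.
    by rewrite wY (dist_reachable (reachable_refl y)) ndistxx.
  have [n wx] := growth_bound wy yx; have [b [bE yb xR ->]] := wX _ _ wx.
  by exists b.
(* The projection is pi on the vertices outside Y, where injectivity of g makes it well defined, and
   the identity on Y. *)
pose k p := if pselect (exists2 x, ~~ inA x & g x = p) is left h
            then g (pi (s2val (cid2 h))) else p.
have kX x : ~~ inA x -> k (g x) = g (pi x).
  move=> xA; rewrite /k; case: pselect => [h|[]]; last by exists x.
  by case: cid2 => x' /= x'A /(expanding_inj g_exp) ->.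
have kY y : k (j y) = j y.
  rewrite /k; case: pselect => // h; case: cid2 => x /= xA xE.
  by have := g_out x xA; rewrite xE image_of_f.
have k_dist y x : reachable (j y) (g x) -> ~~ inA x ->
    reach_of i x /\ ndist (j y) (k (g x)) + ndist (pi x) x <= ndist (j y) (g x).
  move=> /g_dist[b [bE yb xR d]] xA.
  split; first by apply/reach_ofP; exists b; rewrite bE.
  rewrite kX // -bE comm bE; apply: leq_trans d; rewrite leq_add2r.
  exact: dihom_dist.
exists k; split=> //.
- exact: cofibration_expanding.
- exact: pushout_cover.
- move=> p q pq /pushout_cover[x xA xE]; apply/image_ofP => -[y yE].
  have [w [wY wX]] := pushout_from_out xA.
  have wx : w (g x) = Some 0.
    by rewrite wX (negPf xA) (dist_reachable (reachable_refl x)) ndistxx.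
  by move: pq; rewrite -xE -yE => /(growth_bound wx)[b]; rewrite wY.
- move=> y p yp; have [/image_ofP[y' yE]|] := boolP (inY p).
    move: yp; rewrite -yE kY => yp; split=> //; first exact: image_of_f.
      exact: reachable_refl.
    by rewrite ndistxx addn0.
  case/pushout_cover => x xA xE; rewrite -xE in yp *.
  have [b [bE yb xR d]] := g_dist y x yp; rewrite kX // -bE comm.
  split; [exact: image_of_f|exact: dihom_reachable| |].
    by rewrite -comm bE; apply: dihom_reachable.
  apply: leq_trans d; apply: leq_add; first exact: dihom_dist.
  by rewrite -comm bE; apply: dihom_dist.
move=> x xr; have [/image_ofP[a <-]|] := boolP (inA x); last exact: kX.
by rewrite comm kY (contraction_id pi_con) comm.
Qed.

End Pushout.

End PushoutDistances.

(** * Exactness on the second page *)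

Section Representatives.
Variables (R : pzRingType) (V : lmodType R) (Z B : submodClosed V).
Implicit Types (x y : V) (u v : subquot Z B).

(** A relation between classes and representatives reduces exactness to membership statements in the
    complexes, where degrees can be rewritten without transporting elements between pages. *)
Definition repr_by u x : Prop :=
  exists xZ : x \in Z, u = subquot_pi B (Sub x xZ).

Lemma repr_by_mem u x : repr_by u x -> x \in Z.
Proof. by case. Qed.

Lemma repr_by_ex u : exists x, repr_by u x.
Proof.
exists (val (repr u)), (valP (repr u)); rewrite -[LHS]subquot_piK.
by congr subquot_pi; apply: val_inj.
Qed.

Lemma repr_by_of x : x \in Z -> exists u, repr_by u x.
Proof. by move=> xZ; exists (subquot_pi B (Sub x xZ)), xZ. Qed.

Lemma repr_by_eq u v x y :
  repr_by u x -> repr_by v y -> u = v <-> x - y \in B.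
Proof. by move=> [xZ ->] [yZ ->]; apply: subquot_pi_eq. Qed.

Lemma repr_byD u v x y : repr_by u x -> repr_by v y -> repr_by (u + v) (x + y).
Proof.
move=> [xZ ->] [yZ ->]; exists (rpredD xZ yZ).
by rewrite -subquot_piD; congr subquot_pi; apply: val_inj.
Qed.

Lemma repr_byN u x : repr_by u x -> repr_by (- u) (- x).
Proof.
move=> [xZ ->]; exists (submodN xZ).
by rewrite -raddfN; congr subquot_pi; apply: val_inj.
Qed.

Lemma repr_by_eq0 u x : repr_by u x -> u = 0 <-> x \in B.
Proof.
move=> ux; have u0 : repr_by (u - u) (x - x) by apply: repr_byD ux (repr_byN ux).
by move: (repr_by_eq ux u0); rewrite !subrr subr0.
Qed.

End Representatives.

Lemma repr_by_map (R : pzRingType) (V W : lmodType R) (Z B : submodClosed V)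
    (Z' B' : submodClosed W) (h : {linear V -> W})
    (hZ : forall x, x \in Z -> h x \in Z') (hB : forall x, x \in B -> h x \in B')
    (u : subquot Z B) x :
  repr_by u x -> repr_by (subquot_map hZ hB u) (h x).
Proof.
move=> [xZ ->]; exists (hZ _ xZ); rewrite subquot_mapE.
by congr subquot_pi; apply: val_inj.
Qed.

Section SecondPage.
Variables (R : pzRingType) (C : filteredComplex R).
Implicit Types (p n : int) (x : C).

Lemma fil_le p n p' n' x :
  x \in fil C p n -> p <= p' -> n = n' -> x \in fil C p' n'.
Proof.
move=> xF pp' <-; have [m ->] : exists m : nat, p' = p + m%:Z.
  by exists `|p' - p|%N; lia.
elim: m => [|m IHm]; first by rewrite addr0.
by rewrite -addn1 PoszD addrA; apply: fil_incl.
Qed.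

Lemma cycles2P p n x : x \in cycles C 2 p n <->
  x \in fil C p n /\ fc_d C x \in fil C (p - 2) (n - 1).
Proof. by rewrite inE; split=> [/andP|?]; last exact/andP. Qed.

Lemma boundaries2P p n x : x \in boundaries C 2 p n <->
  exists y z, [/\ x = y + fc_d C z,
    y \in fil C (p - 1) n, fc_d C y \in fil C (p - 2) (n - 1),
    z \in fil C (p + 1) (n + 1) & fc_d C z \in fil C p n].
Proof.
rewrite inE; split=> [/asboolP|] [y [z]].
  case=> /andP[yF dyF] /andP[zF dzF] ->; exists y, z; split=> //.
  - by apply: fil_le dyF _ _; lia.
  - by apply: fil_le zF _ _; lia.
  by apply: fil_le dzF _ _; lia.
case=> -> yF dyF zF dzF; apply/asboolP.
exists y, z; split=> //; apply/andP; split=> //.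
- by apply: fil_le dyF _ _; lia.
- by apply: fil_le zF _ _; lia.
by apply: fil_le dzF _ _; lia.
Qed.

End SecondPage.

Lemma repr_by_page_map (R : pzRingType) (C D : filteredComplex R)
    (h : filteredMap C D) (r : nat) (p q : int) (u : page C r p q) x :
  repr_by u x -> repr_by (page_map h r p q u) (h x).
Proof. exact: repr_by_map. Qed.

(* The maps q, r and s make up a filtered chain map from P to the mapping cone of
   (i, - f), inverse to (g, j) up to the homotopy h; rX and hX are the maps r and
   h for X itself, seen as the pushout of i along the identity of A. *)
Record splitting (R : pzRingType) (A X Y P : filteredComplex R)
    (i : filteredMap A X) (f : filteredMap A Y)
    (g : filteredMap X P) (j : filteredMap Y P) := Splitting {
  sp_q : {linear P -> X};
  sp_r : {linear P -> Y};
  sp_s : {linear P -> A};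
  sp_h : {linear P -> P};
  sp_rX : {linear X -> A};
  sp_hX : {linear X -> X};
  sp_square : forall a, g (i a) = j (f a);
  sp_q_fil : forall p n z, z \in fil P p n -> sp_q z \in fil X p n;
  sp_r_fil : forall p n z, z \in fil P p n -> sp_r z \in fil Y p n;
  sp_s_fil : forall p n z,
    z \in fil P p n -> sp_s z \in fil A (p - 1) (n - 1);
  sp_h_fil : forall p n z, z \in fil P p n -> sp_h z \in fil P p (n + 1);
  sp_rX_fil : forall p n x, x \in fil X p n -> sp_rX x \in fil A p n;
  sp_hX_fil : forall p n x, x \in fil X p n -> sp_hX x \in fil X p (n + 1);
  sp_q_d : forall z, fc_d X (sp_q z) - sp_q (fc_d P z) = - i (sp_s z);
  sp_r_d : forall z, fc_d Y (sp_r z) - sp_r (fc_d P z) = f (sp_s z);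
  sp_s_d : forall z, fc_d A (sp_s z) + sp_s (fc_d P z) = 0;
  sp_h_d : forall z,
    fc_d P (sp_h z) + sp_h (fc_d P z) = z - g (sp_q z) - j (sp_r z);
  sp_rX_d : forall x, fc_d A (sp_rX x) - sp_rX (fc_d X x) = sp_s (g x);
  sp_hX_d : forall x,
    fc_d X (sp_hX x) + sp_hX (fc_d X x) = x - sp_q (g x) - i (sp_rX x);
  sp_r_g : forall x, sp_r (g x) = f (sp_rX x);
  sp_rX_i : forall a, sp_rX (i a) = a;
  sp_q_j : forall y, sp_q (j y) = 0;
  sp_r_j : forall y, sp_r (j y) = y;
  sp_s_j : forall y, sp_s (j y) = 0 }.

Ltac int_lia := clear; lia.

Section Exactness.
Variables (R : pzRingType) (A X Y P : filteredComplex R).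
Variables (i : filteredMap A X) (f : filteredMap A Y).
Variables (g : filteredMap X P) (j : filteredMap Y P).
Variable sp : splitting i f g j.
Local Notation d := (fc_d _).
Local Notation q := (sp_q sp).
Local Notation r := (sp_r sp).
Local Notation s := (sp_s sp).
Local Notation h := (sp_h sp).
Local Notation rX := (sp_rX sp).
Local Notation hX := (sp_hX sp).
Let dq z : d (q z) = q (d z) - i (s z).
Proof. by rewrite -sp_q_d addrC subrK. Qed.
Let dr z : d (r z) = r (d z) + f (s z).
Proof. by rewrite -sp_r_d addrC subrK. Qed.
Let ds z : d (s z) = - s (d z).
Proof. by apply/eqP; rewrite -addr_eq0 sp_s_d. Qed.
Let drX x : d (rX x) = rX (d x) + s (g x).
Proof. by rewrite -sp_rX_d addrC subrK. Qed.

Lemma connecting_cycles p n z :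
  z \in cycles P 2 p n -> s z \in cycles A 2 (p - 1) (n - 1).
Proof.
move=> /cycles2P[zF dzF]; apply/cycles2P; split; first exact: sp_s_fil.
by rewrite ds submodN //; apply: (fil_le (sp_s_fil sp dzF)); int_lia.
Qed.

Lemma connecting_boundaries p n z :
  z \in boundaries P 2 p n -> s z \in boundaries A 2 (p - 1) (n - 1).
Proof.
move=> /boundaries2P[u [v [-> uF duF vF dvF]]]; apply/boundaries2P.
have dsv : d (- s v) = s (d v) by rewrite linearN /= ds opprK.
exists (s u), (- s v); rewrite dsv linearD /=; split=> //.
- exact: sp_s_fil.
- by rewrite ds submodN //; apply: (fil_le (sp_s_fil sp duF)); int_lia.
- by rewrite submodN //; apply: (fil_le (sp_s_fil sp vF)); int_lia.
exact: sp_s_fil.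
Qed.

(** The failure of q to commute with d is i (s z), which lies one filtration step below z. So q
    still preserves elements whose differential drops the filtration by one. *)
Let q_dF (p n : int) z : z \in fil P (p + 1) n -> d z \in fil P p (n - 1) ->
  d (q z) \in fil X p (n - 1).
Proof.
move=> zF dzF; rewrite dq submodB ?sp_q_fil // fm_fil //.
by apply: (fil_le (sp_s_fil sp zF)); int_lia.
Qed.

Let r_dF (p n : int) z : z \in fil P (p + 1) n -> d z \in fil P p (n - 1) ->
  d (r z) \in fil Y p (n - 1).
Proof.
move=> zF dzF; rewrite dr rpredD ?sp_r_fil // fm_fil //.
by apply: (fil_le (sp_s_fil sp zF)); int_lia.
Qed.

Let rX_dF (p n : int) x : x \in fil X (p + 1) n -> d x \in fil X p (n - 1) ->
  d (rX x) \in fil A p (n - 1).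
Proof.
move=> xF dxF; rewrite drX rpredD ?sp_rX_fil //.
by apply: (fil_le (sp_s_fil sp (fm_fil g xF))); int_lia.
Qed.

Lemma exact_sum p n x y : x \in cycles X 2 p n -> y \in cycles Y 2 p n ->
  g x + j y \in boundaries P 2 p n ->
  exists2 a, a \in cycles A 2 p n &
    x - i a \in boundaries X 2 p n /\ y + f a \in boundaries Y 2 p n.
Proof.
move=> /cycles2P[xF dxF] /cycles2P[yF dyF].
move=> /boundaries2P[u [v [uvE uF duF vF dvF]]].
have sx : s (g x) = s u - d (s v).
  by rewrite -[LHS]addr0 -(sp_s_j sp y) -linearD /= uvE linearD /= ds opprK.
(* The differential of [rX x] is rX (d x) + s u - d (s v); adding [s v] removes the only term not
   known to lie in filtration p - 2. *)
exists (rX x + s v).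
  apply/cycles2P; split.
    by rewrite rpredD ?sp_rX_fil //; apply: (fil_le (sp_s_fil sp vF)); int_lia.
  rewrite linearD /= drX sx -addrA subrK rpredD ?sp_rX_fil //.
  by apply: (fil_le (sp_s_fil sp uF)); int_lia.
split; apply/boundaries2P.
  exists (q u + hX (d x)), (q v + hX x); split.
  - have := congr1 q uvE; rewrite !linearD /= sp_q_j addr0 => qgx.
    have := sp_hX_d sp x; rewrite qgx -[q (d v)](subrK (i (s v))) -dq.
    by move=> /(canRL (addrK _)) ->; zmod.
  - by rewrite rpredD ?sp_q_fil //; apply: (fil_le (sp_hX_fil sp dxF)); int_lia.
  - rewrite linearD rpredD //; last first.
      by apply: (fil_le (fil_d (sp_hX_fil sp dxF))); int_lia.
    by apply: q_dF => //; apply: (fil_le uF); int_lia.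
  - by rewrite rpredD ?sp_q_fil //; apply: (fil_le (sp_hX_fil sp xF)); int_lia.
  rewrite linearD rpredD //; last first.
    by apply: (fil_le (fil_d (sp_hX_fil sp xF))); int_lia.
  apply: (@fil_le _ _ p (n + 1 - 1)); [|int_lia|int_lia].
  by apply: q_dF; rewrite ?addrK.
exists (r u), (r v); split.
- have := congr1 r uvE; rewrite !linearD /= sp_r_j sp_r_g dr.
  by move=> /(canRL (addKr _)) ->; zmod.
- exact: sp_r_fil.
- by apply: r_dF => //; apply: (fil_le uF); int_lia.
- exact: sp_r_fil.
apply: (@fil_le _ _ p (n + 1 - 1)); [|int_lia|int_lia].
by apply: r_dF; rewrite ?addrK.
Qed.

Lemma connecting_sum p n x y :
  x \in cycles X 2 p n -> s (g x + j y) \in boundaries A 2 (p - 1) (n - 1).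
Proof.
move=> /cycles2P[xF dxF]; rewrite linearD /= sp_s_j addr0; apply/boundaries2P.
exists (- rX (d x)), (rX x); split.
- by rewrite drX addKr.
- by rewrite submodN //; apply: (fil_le (sp_rX_fil sp dxF)); int_lia.
- rewrite linearN submodN // drX fc_dd raddf0 add0r.
  by apply: (fil_le (sp_s_fil sp (fm_fil g dxF))); int_lia.
- by apply: (fil_le (sp_rX_fil sp xF)); int_lia.
by apply: rX_dF; [apply: (fil_le xF)|apply: (fil_le dxF)]; int_lia.
Qed.

Lemma exact_pushout p n z : z \in cycles P 2 p n ->
  s z \in boundaries A 2 (p - 1) (n - 1) ->
  exists x y, [/\ x \in cycles X 2 p n, y \in cycles Y 2 p n &
    z - (g x + j y) \in boundaries P 2 p n].
Proof.
move=> /cycles2P[zF dzF] /boundaries2P[u [v [szE uF duF vF dvF]]].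
have {}vF : v \in fil A p n by apply: (fil_le vF); int_lia.
have {}uF : u \in fil A (p - 2) (n - 1) by apply: (fil_le uF); int_lia.
exists (q z + i v), (r z - f v); split.
- apply/cycles2P; split; first by rewrite rpredD ?sp_q_fil ?fm_fil.
  rewrite linearD /= dq szE linearD /= -fm_d.
  have -> : q (d z) - (i u + i (d v)) + i (d v) = q (d z) - i u by zmod.
  by rewrite submodB ?sp_q_fil ?fm_fil.
- apply/cycles2P; split; first by rewrite submodB ?sp_r_fil ?fm_fil.
  rewrite linearB /= dr szE linearD /= -fm_d.
  have -> : r (d z) + (f u + f (d v)) - f (d v) = r (d z) + f u by zmod.
  by rewrite rpredD ?sp_r_fil ?fm_fil.
apply/boundaries2P; exists (h (d z)), (h z); split.
- rewrite [RHS]addrC sp_h_d [g (_ + _)]linearD [j (_ - _)]linearB /=.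
  by rewrite -(sp_square sp); zmod.
- by apply: (fil_le (sp_h_fil sp dzF)); int_lia.
- by apply: (fil_le (fil_d (sp_h_fil sp dzF))); int_lia.
- by apply: (fil_le (sp_h_fil sp zF)); int_lia.
by apply: (fil_le (fil_d (sp_h_fil sp zF))); int_lia.
Qed.

Lemma connecting_i p n z : z \in cycles P 2 p n ->
  i (s z) \in boundaries X 2 (p - 1) (n - 1).
Proof.
move=> /cycles2P[zF dzF]; apply/boundaries2P.
exists (q (d z)), (- q z); split.
- by rewrite linearN /= dq; zmod.
- by apply: (fil_le (sp_q_fil sp dzF)); int_lia.
- rewrite dq fc_dd raddf0 add0r submodN // fm_fil //.
  by apply: (fil_le (sp_s_fil sp dzF)); int_lia.
- by rewrite submodN //; apply: (fil_le (sp_q_fil sp zF)); int_lia.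
rewrite linearN submodN //.
by apply: q_dF; [apply: (fil_le zF)|apply: (fil_le dzF)]; int_lia.
Qed.

Lemma connecting_f p n z : z \in cycles P 2 p n ->
  f (s z) \in boundaries Y 2 (p - 1) (n - 1).
Proof.
move=> /cycles2P[zF dzF]; apply/boundaries2P.
exists (- r (d z)), (r z); split.
- by rewrite dr addKr.
- by rewrite submodN //; apply: (fil_le (sp_r_fil sp dzF)); int_lia.
- rewrite linearN submodN // dr fc_dd raddf0 add0r fm_fil //.
  by apply: (fil_le (sp_s_fil sp dzF)); int_lia.
- by apply: (fil_le (sp_r_fil sp zF)); int_lia.
by apply: r_dF; [apply: (fil_le zF)|apply: (fil_le dzF)]; int_lia.
Qed.

Lemma exact_connecting p n a : a \in cycles A 2 p n ->
  i a \in boundaries X 2 p n -> f a \in boundaries Y 2 p n ->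
  exists2 z, z \in cycles P 2 (p + 1) (n + 1) & a - s z \in boundaries A 2 p n.
Proof.
move=> /cycles2P[aF daF] /boundaries2P[u [v [iaE uF duF vF dvF]]].
move=> /boundaries2P[u' [v' [faE uF' duF' vF' dvF']]].
(* As v and v' bound i a and f a up to u and u', the equality g i = j f reduces the differential to
   g u - j u'. *)
exists (j v' - g v).
  apply/cycles2P; split; first by rewrite submodB ?fm_fil.
  have dv : d v = i a - u by rewrite iaE addrC addKr.
  have dv' : d v' = f a - u' by rewrite faE addrC addKr.
  rewrite linearB /= -!fm_d dv dv' [j (_ - _)]linearB [g (_ - _)]linearB /=.
  rewrite (sp_square sp).
  have -> : j (f a) - j u' - (j (f a) - g u) = g u - j u' by zmod.
  by rewrite submodB // fm_fil //; [apply: (fil_le uF)|apply: (fil_le uF')]; int_lia.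
(* Applying rX to i a = u + d v recovers a, and s (g v) is the defect of rX at v. *)
apply/boundaries2P; exists (rX u), (rX v); split.
- have := drX v; rewrite linearB /= sp_s_j sub0r opprK => ->.
  have := congr1 rX iaE; rewrite sp_rX_i linearD /= => ->; zmod.
- exact: sp_rX_fil.
- by apply: rX_dF => //; apply: (fil_le uF); int_lia.
- exact: sp_rX_fil.
apply: (@fil_le _ _ p (n + 1 - 1)); [|int_lia|int_lia].
by apply: rX_dF; rewrite ?addrK.
Qed.

Lemma connecting_degree (k l : int) : l - 1 + (k - 1 - (l - 1)) = l + (k - l) - 1.
Proof. by int_lia. Qed.

Lemma connecting_cycles_page k l z : z \in cycles P 2%:Z l (l + (k - l)) ->
  s z \in cycles A 2%:Z (l - 1) (l - 1 + (k - 1 - (l - 1))).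
Proof. by rewrite connecting_degree; apply: connecting_cycles. Qed.

Lemma connecting_boundaries_page k l z : z \in boundaries P 2%:Z l (l + (k - l)) ->
  s z \in boundaries A 2%:Z (l - 1) (l - 1 + (k - 1 - (l - 1))).
Proof. by rewrite connecting_degree; apply: connecting_boundaries. Qed.

Definition connecting k l :
    {linear page P 2 l (k - l) -> page A 2 (l - 1) (k - 1 - (l - 1))} :=
  subquot_map (@connecting_cycles_page k l) (@connecting_boundaries_page k l).

Definition antidiagonal k l (a : page A 2 l (k - l)) :
    page X 2 l (k - l) * page Y 2 l (k - l) :=
  (page_map i 2 l (k - l) a, - page_map f 2 l (k - l) a).
Definition codiagonal k l (uv : page X 2 l (k - l) * page Y 2 l (k - l)) :
    page P 2 l (k - l) :=
  page_map g 2 l (k - l) uv.1 + page_map j 2 l (k - l) uv.2.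

Lemma repr_by_codiagonal k l u v x y :
  repr_by u x -> repr_by v y -> repr_by (@codiagonal k l (u, v)) (g x + j y).
Proof. by move=> ux vy; apply: repr_byD; apply: repr_by_page_map. Qed.

Lemma repr_by_connecting k l w z :
  repr_by w z -> repr_by (connecting k l w) (s z).
Proof. exact: repr_by_map. Qed.

Lemma exact_at_sum k l : exact_at (@antidiagonal k l) (@codiagonal k l).
Proof.
move=> [u v]; split=> [|[e <-]].
  have [x ux] := repr_by_ex u; have [y vy] := repr_by_ex v.
  move/(repr_by_eq0 (repr_by_codiagonal ux vy)).
  case/(exact_sum (repr_by_mem ux) (repr_by_mem vy)) => a aZ [xa ya].
  have [e ea] := repr_by_of (boundaries A 2%:Z l (l + (k - l))) aZ.
  exists e; congr (_, _).
    by apply/(repr_by_eq (repr_by_page_map i ea) ux); rewrite -opprB submodN.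
  apply/(repr_by_eq (repr_byN (repr_by_page_map f ea)) vy).
  by rewrite -opprD addrC submodN.
have [a ea] := repr_by_ex e; have ia := repr_by_page_map i ea.
apply/(repr_by_eq0 (repr_by_codiagonal ia (repr_byN (repr_by_page_map f ea)))).
by rewrite linearN /= (sp_square sp) subrr rpred0.
Qed.

Lemma exact_at_pushout k l : exact_at (@codiagonal k l) (connecting k l).
Proof.
move=> w; split=> [|[[u v] <-]].
  have [z wz] := repr_by_ex w.
  move/(repr_by_eq0 (repr_by_connecting wz)); rewrite connecting_degree.
  case/(exact_pushout (repr_by_mem wz)) => x [y [xZ yZ zxy]].
  have [u ux] := repr_by_of (boundaries X 2%:Z l (l + (k - l))) xZ.
  have [v vy] := repr_by_of (boundaries Y 2%:Z l (l + (k - l))) yZ.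
  exists (u, v); apply/(repr_by_eq (repr_by_codiagonal ux vy) wz).
  by rewrite -opprB submodN.
have [x ux] := repr_by_ex u; have [y vy] := repr_by_ex v.
apply/(repr_by_eq0 (repr_by_connecting (repr_by_codiagonal ux vy))).
by rewrite connecting_degree; apply: connecting_sum (repr_by_mem ux).
Qed.

Lemma exact_at_connecting k l :
  exact_at (connecting k l) (@antidiagonal (k - 1) (l - 1)).
Proof.
move=> e; split=> [|[w <-]].
  have [a ea] := repr_by_ex e; case.
  move/(repr_by_eq0 (repr_by_page_map i ea)) => iaB.
  move/(repr_by_eq0 (repr_byN (repr_by_page_map f ea))) => /submodN.
  rewrite opprK => faB; move: (repr_by_mem ea) iaB faB; rewrite connecting_degree.
  move=> aZ iaB faB; have [z] := exact_connecting aZ iaB faB.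
  rewrite !subrK => zZ az.
  have [w wz] := repr_by_of (boundaries P 2%:Z l (l + (k - l))) zZ.
  exists w; apply/(repr_by_eq (repr_by_connecting wz) ea).
  by rewrite connecting_degree -opprB submodN.
have [z wz] := repr_by_ex w; have zZ := repr_by_mem wz.
congr (_, _).
  apply/(repr_by_eq0 (repr_by_page_map i (repr_by_connecting wz))).
  by rewrite connecting_degree; apply: connecting_i zZ.
apply/(repr_by_eq0 (repr_byN (repr_by_page_map f (repr_by_connecting wz)))).
by rewrite connecting_degree submodN //; apply: connecting_f zZ.
Qed.

End Exactness.

(** * The long exact sequence *)

Section GluingComplexes.
Variables (R : pzRingType) (A X Y P : digraph).
Variables (i : dihom A X) (f : dihom A Y) (g : dihom X P) (j : dihom Y P).
Variables (pi : X -> X) (k : P -> P).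
Hypothesis gl : gluing i f g j pi k.

Definition RC_q : {linear RC R P -> RC R X} := RC_op (wop_q i g j pi).
Definition RC_r : {linear RC R P -> RC R Y} := RC_op (wop_r j k).
Definition RC_s : {linear RC R P -> RC R A} := RC_op (wop_s i g j pi).
Definition RC_h : {linear RC R P -> RC R P} := RC_op (wop_h j k).

Local Notation fg := (RC_fmap R g).
Local Notation fj := (RC_fmap R j).
Local Notation fi := (RC_fmap R i).
Local Notation ff := (RC_fmap R f).

Let qE t : t \in flmod_span (the_free_lmod R (seq P)) (@rsorted P) ->
  RC_q (word_chain R P t) = word_chain R X (wop_q i g j pi t).
Proof. exact/RC_op_word/wop_q_op/gl. Qed.
Let rE t : t \in flmod_span (the_free_lmod R (seq P)) (@rsorted P) ->
  RC_r (word_chain R P t) = word_chain R Y (wop_r j k t).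
Proof. exact/RC_op_word/wop_r_op/gl. Qed.
Let sE t : t \in flmod_span (the_free_lmod R (seq P)) (@rsorted P) ->
  RC_s (word_chain R P t) = word_chain R A (wop_s i g j pi t).
Proof. exact/RC_op_word/wop_s_op/gl. Qed.
Let hE t : t \in flmod_span (the_free_lmod R (seq P)) (@rsorted P) ->
  RC_h (word_chain R P t) = word_chain R P (wop_h j k t).
Proof. exact/RC_op_word/wop_h_op/gl. Qed.

Section Differentials.
Variable z : RC R P.
Let t := chain_word R P z.
Let zE : z = word_chain R P t. Proof. by rewrite chain_wordK. Qed.
Let tS : t \in flmod_span (the_free_lmod R (seq P)) (@rsorted P).
Proof. exact: chain_word_sorted. Qed.
Let dtS := rsorted_bd tS.
Let qS := word_op_sorted (wop_q_op R gl) tS.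
Let rS := word_op_sorted (wop_r_op R gl) tS.
Let sS := word_op_sorted (wop_s_op R gl) tS.
Let hS := word_op_sorted (wop_h_op R gl) tS.

Lemma RC_h_d : fc_d _ (RC_h z) + RC_h (fc_d _ z) =
  z - fg (RC_q z) - fj (RC_r z).
Proof.
rewrite zE word_chain_d // qE // rE // !hE // word_chain_d // !word_chain_map //.
by rewrite -raddfD -!raddfB (wop_h_bd gl tS).
Qed.

Lemma RC_q_d : fc_d _ (RC_q z) - RC_q (fc_d _ z) = - fi (RC_s z).
Proof.
rewrite zE word_chain_d // !qE // sE // word_chain_d // word_chain_map //.
by rewrite -raddfB (wop_q_bd gl tS) raddfN.
Qed.

Lemma RC_r_d : fc_d _ (RC_r z) - RC_r (fc_d _ z) = ff (RC_s z).
Proof.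
rewrite zE word_chain_d // !rE // sE // word_chain_d // word_chain_map //.
by rewrite -raddfB (wop_r_bd gl tS).
Qed.

Lemma RC_s_d : fc_d _ (RC_s z) + RC_s (fc_d _ z) = 0.
Proof.
rewrite zE word_chain_d // !sE // word_chain_d //.
by rewrite -raddfD (wop_s_bd gl tS) raddf0.
Qed.

End Differentials.

Lemma wmap_sorted (G H : digraph) (e : dihom G H)
    (t : the_free_lmod R (seq G)) :
  t \in flmod_span (the_free_lmod R (seq G)) (@rsorted G) ->
  wmap e t \in flmod_span (the_free_lmod R (seq H)) (@rsorted H).
Proof.
apply: flmod_span_linear => s ss; rewrite [X in X \in _]wmap_gen.
exact/flmod_span_gen/dihom_sorted.
Qed.

Lemma RC_r_j y : RC_r (fj y) = y.
Proof.
have yS := chain_word_sorted y; rewrite -[y]chain_wordK word_chain_map //.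
by rewrite rE ?(wop_r_in gl) // wmap_sorted.
Qed.

Lemma RC_q_j y : RC_q (fj y) = 0.
Proof.
have yS := chain_word_sorted y; rewrite -[y]chain_wordK word_chain_map //.
by rewrite qE ?(wop_q_j gl) // wmap_sorted.
Qed.

Lemma RC_s_j y : RC_s (fj y) = 0.
Proof.
have yS := chain_word_sorted y; rewrite -[y]chain_wordK word_chain_map //.
by rewrite sE ?(wop_s_j gl) // wmap_sorted.
Qed.

Lemma RC_square a : fg (fi a) = fj (ff a).
Proof.
have aS := chain_word_sorted a; rewrite -[a]chain_wordK.
rewrite !word_chain_map ?wmap_sorted //; apply: (congr1 (word_chain R P)).
move: (chain_word R A a); apply: (@lmod_eq _ _ _ (@wmap R X P g \o @wmap R A X i)
  (@wmap R Y P j \o @wmap R A Y f)) => s /=.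
rewrite !wmap_gen -!map_comp; congr flmod_gen; apply: eq_map => b /=.
exact: gl_comm gl b.
Qed.

Lemma RC_q_fil p n z : z \in fil (RC R P) p n -> RC_q z \in fil (RC R X) p n.
Proof. by move/(RC_op_fil (wop_q_op R gl)); rewrite !addr0. Qed.

Lemma RC_r_fil p n z : z \in fil (RC R P) p n -> RC_r z \in fil (RC R Y) p n.
Proof. by move/(RC_op_fil (wop_r_op R gl)); rewrite !addr0. Qed.

Lemma RC_s_fil p n z :
  z \in fil (RC R P) p n -> RC_s z \in fil (RC R A) (p - 1) (n - 1).
Proof. exact: (RC_op_fil (wop_s_op R gl)). Qed.

Lemma RC_h_fil p n z :
  z \in fil (RC R P) p n -> RC_h z \in fil (RC R P) p (n + 1).
Proof. by move/(RC_op_fil (wop_h_op R gl)); rewrite addr0. Qed.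

End GluingComplexes.

Lemma RC_map_id (R : pzRingType) (G : digraph) z : RC_fmap R (dihom_id G) z = z.
Proof.
have zS := chain_word_sorted z; rewrite -[z in LHS]chain_wordK word_chain_map //.
rewrite -[RHS]chain_wordK; apply: (congr1 (word_chain R G)).
move: (chain_word R G z).
apply: (@lmod_eq _ _ _ (@wmap R G G idfun) idfun) => s.
by rewrite /= wmap_gen map_id.
Qed.

(** * Compatibility of the operators of P with those of X *)

Section GluingNaturality.
Variables (R : pzRingType) (A X Y P : digraph).
Variables (i : dihom A X) (f : dihom A Y) (g : dihom X P) (j : dihom Y P).
Variables (pi : X -> X) (k : P -> P).
Hypothesis gl : gluing i f g j pi k.
Let gl' := gluing_self gl.
Variable x : RC R X.
Let t := chain_word R X x.
Let xE : x = word_chain R X t. Proof. by rewrite chain_wordK. Qed.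
Let tS : t \in flmod_span (the_free_lmod R (seq X)) (@rsorted X).
Proof. exact: chain_word_sorted. Qed.
Let gtS := wmap_sorted g tS.

Lemma RC_q_g : RC_q R i g j pi (RC_fmap R g x) = RC_q R i (dihom_id X) i pi x.
Proof.
rewrite xE word_chain_map // (RC_op_word (wop_q_op R gl)) //.
rewrite (RC_op_word (wop_q_op R gl')) //; apply: (congr1 (word_chain R X)).
exact: (wop_q_map gl).
Qed.

Lemma RC_s_g : RC_s R i g j pi (RC_fmap R g x) = RC_s R i (dihom_id X) i pi x.
Proof.
rewrite xE word_chain_map // (RC_op_word (wop_s_op R gl)) //.
rewrite (RC_op_word (wop_s_op R gl')) //; apply: (congr1 (word_chain R A)).
exact: (wop_s_map gl).
Qed.

Lemma RC_r_g : RC_r R j k (RC_fmap R g x) = RC_fmap R f (RC_r R i pi x).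
Proof.
have rS := word_op_sorted (wop_r_op R gl') tS.
rewrite xE word_chain_map // (RC_op_word (wop_r_op R gl)) //.
rewrite (RC_op_word (wop_r_op R gl')) // word_chain_map //.
by apply: (congr1 (word_chain R Y)); exact: (wop_r_map gl).
Qed.

End GluingNaturality.

Definition RC_splitting (R : pzRingType) (A X Y P : digraph)
    (i : dihom A X) (f : dihom A Y) (g : dihom X P) (j : dihom Y P)
    (pi : X -> X) (k : P -> P) (gl : gluing i f g j pi k) :
  splitting (RC_fmap R i) (RC_fmap R f) (RC_fmap R g) (RC_fmap R j).
Proof.
have gl' := gluing_self gl.
apply: (@Splitting R _ _ _ _ _ _ _ _ (RC_q R i g j pi) (RC_r R j k)
  (RC_s R i g j pi) (RC_h R j k) (RC_r R i pi) (RC_h R i pi)).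
- exact: RC_square gl.
- exact: RC_q_fil gl.
- exact: RC_r_fil gl.
- exact: RC_s_fil gl.
- exact: RC_h_fil gl.
- exact: RC_r_fil gl'.
- exact: RC_h_fil gl'.
- exact: RC_q_d gl.
- exact: RC_r_d gl.
- exact: RC_s_d gl.
- exact: RC_h_d gl.
- by move=> x; rewrite (RC_r_d gl') RC_map_id (RC_s_g gl).
- by move=> x; rewrite (RC_h_d gl') RC_map_id (RC_q_g gl).
- exact: RC_r_g gl.
- exact: RC_r_j gl'.
- exact: RC_q_j gl.
- exact: RC_r_j gl.
exact: RC_s_j gl.
Qed.

Theorem theorem6p8 (R : comPzRingType) (A X Y P : digraph)
    (i : dihom A X) (f : dihom A Y) (g : dihom X P) (j : dihom Y P)
    (i_cofibration : cofibration i) (P_pushout : is_pushout i f g j) :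
  let alpha k l (a : PH R A k l) : PH R X k l * PH R Y k l :=
    (PH_map R i k l a, - PH_map R f k l a) in
  let beta k l (uv : PH R X k l * PH R Y k l) : PH R P k l :=
    PH_map R g k l uv.1 + PH_map R j k l uv.2 in
  exists delta : forall k l : int, {linear PH R P k l -> PH R A (k - 1) (l - 1)},
    forall k l : int,
      [/\ exact_at (alpha k l) (beta k l),
          exact_at (beta k l) (delta k l) &
          exact_at (delta k l) (alpha (k - 1) (l - 1))].
Proof.
move=> alpha beta.
have [pi pi_con] := cofibration_projection i_cofibration.
have [k gl] := pushout_gluing i_cofibration P_pushout pi_con.
pose sp := RC_splitting R gl.
exists (fun k l => connecting sp k l) => m l; split.
- exact: exact_at_sum.
- exact: exact_at_pushout.
exact: exact_at_connecting.
Qed.
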